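(* Let $n,m$ be relatively prime natural numbers with $m<2n<\sqrt{2}\,m$. Then for every $p\in(0,1)$ there exists $a=a_{n,m}>p^p(1-p)^{1-p}$ with $\Lambda_p(a)=2\pi n/m$, and the corresponding $p$-elastic curve $\gamma_{n,m}:=\gamma_a$ in $\mathbb{S}^2$ is a closed curve with non-constant curvature; it closes up after $m$ periods of its curvature, with total angular progression $2\pi n$ around the pole.
   Context: $\mathbb{S}^2$ is the unit sphere in $\mathbb{R}^3$; geodesic curvature $\kappa$ of an arc-length parametrized curve is defined by $\nabla_T T=\kappa N$ with $T=\gamma'$ and $N$ the rotation of $T$ by $+\pi/2$ in the tangent plane. For $p\in(0,1)$, $\mathbf{\Theta}_p(\gamma)=\int_\gamma\kappa^p\,ds$ acts on convex curves ($\kappa>0$), and a $p$-elastic curve is a convex curve with $p\,(\kappa^{p-1})''+(p-1)\kappa^{p+1}+p\,\kappa^{p-1}=0$. For $a>a_*:=p^p(1-p)^{1-p}$, $\gamma_a$ denotes the (unique up to isometries of $\mathbb{S}^2$ and shifts of $s$) $p$-elastic curve, defined on $\mathbb{R}$, whose non-constant periodic curvature satisfies $p^2(p-1)^2\kappa^{2(p-2)}(\kappa')^2+(p-1)^2\kappa^{2p}+p^2\kappa^{2(p-1)}=a$. With $Q_{p,a}(\kappa)=a\kappa^{2(1-p)}-(1-p)^2\kappa^2-p^2$ and $\beta<\alpha$ its two positive zeros, $\Lambda_p(a)=2p(1-p)^2\sqrt{a}\int_\beta^\alpha \kappa^{1-p}\big((a\kappa^{2(1-p)}-p^2)\sqrt{Q_{p,a}(\kappa)}\big)^{-1}d\kappa$,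 which equals the angular progression $(1-p)\sqrt a\int_0^\varrho \kappa^{2-p}/(a\kappa^{2(1-p)}-p^2)\,ds$ of $\gamma_a$ over one period $\varrho$ of its curvature. *)

(* Defs.v *)
From Stdlib Require Import Reals Lra.
From Coquelicot Require Import Coquelicot.
Open Scope R_scope.

Definition a_star (p : R) : R := Rpower p p * Rpower (1 - p) (1 - p).

Definition Qpa (p a k : R) : R :=
  a * Rpower k (2 * (1 - p)) - (1 - p) ^ 2 * k ^ 2 - p ^ 2.

Definition Lambda_integrand (p a k : R) : R :=
  2 * p * (1 - p) ^ 2 * sqrt a * Rpower k (1 - p)
  / ((a * Rpower k (2 * (1 - p)) - p ^ 2) * sqrt (Qpa p a k)).

Definition Lambda_is (p a v : R) : Prop :=
  exists beta alpha : R,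
    0 < beta /\ beta < alpha /\ Qpa p a beta = 0 /\ Qpa p a alpha = 0 /\
    (forall k, 0 < k -> Qpa p a k = 0 -> k = beta \/ k = alpha) /\
    is_RInt_gen (Lambda_integrand p a) (at_right beta) (at_left alpha) v.

Definition smooth (f : R -> R) : Prop := forall (k : nat) (x : R), ex_derive_n f k x.

Definition det3 (x1 y1 z1 x2 y2 z2 x3 y3 z3 : R) : R :=
  x1 * (y2 * z3 - z2 * y3) - y1 * (x2 * z3 - z2 * x3) + z1 * (x2 * y3 - y2 * x3).

(** geodesic curvature of an arc-length parametrized curve
    gamma = (gx, gy, gz) on S^2:  kappa = <gamma'', N>, N = gamma x gamma',
    i.e. kappa = det(gamma, gamma', gamma''). *)
Definition gcurv (gx gy gz : R -> R) (s : R) : R :=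
  det3 (gx s) (gy s) (gz s)
       (Derive gx s) (Derive gy s) (Derive gz s)
       (Derive_n gx 2 s) (Derive_n gy 2 s) (Derive_n gz 2 s).

Definition is_gamma_a (p a : R) (gx gy gz : R -> R) (rho : R) : Prop :=
  let kappa := gcurv gx gy gz in
  smooth gx /\ smooth gy /\ smooth gz /\
  (forall s, gx s ^ 2 + gy s ^ 2 + gz s ^ 2 = 1) /\
  (forall s, Derive gx s ^ 2 + Derive gy s ^ 2 + Derive gz s ^ 2 = 1) /\
  (forall s, 0 < kappa s) /\
  (* p-elastic equation *)
  (forall s, p * Derive_n (fun t => Rpower (kappa t) (p - 1)) 2 s
             + (p - 1) * Rpower (kappa s) (p + 1)
             + p * Rpower (kappa s) (p - 1) = 0) /\
  (* first integral with constant a *)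
  (forall s, p ^ 2 * (p - 1) ^ 2 * Rpower (kappa s) (2 * (p - 2)) * (Derive kappa s) ^ 2
             + (p - 1) ^ 2 * Rpower (kappa s) (2 * p)
             + p ^ 2 * Rpower (kappa s) (2 * (p - 1)) = a) /\
  (exists s t, kappa s <> kappa t) /\
  0 < rho /\ (forall s, kappa (s + rho) = kappa s) /\
  (forall t, 0 < t < rho -> ~ (forall s, kappa (s + t) = kappa s)).

Definition angular_integrand (p a : R) (gx gy gz : R -> R) (s : R) : R :=
  (1 - p) * sqrt a * Rpower (gcurv gx gy gz s) (2 - p)
  / (a * Rpower (gcurv gx gy gz s) (2 * (1 - p)) - p ^ 2).

(* Main.v *)
(** Writing z for the height of the curve over the equator of its axis and nu for its momentum
about that axis, the first integral reads z^2 + z'^2 + nu^2 = 1 with nu a power of z. With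
y = z^2 and w = z'/nu it becomes pot(y) + ln (1 + w^2) = E^2, where E^2 = ln (a / a_star)
/ (1 - p) and pot has a nondegenerate minimum 0 at y = p. Both summands are squares of C^1
coordinates x(y), v(w) ("signed roots"), in which the motion is a rotation of radius E
with positive angular speed; so one period of the curvature is one full turn of the phase
t, and Lambda_p(a) is the integral over a turn of a function psi E t that is jointly
continuous, including at E = 0. There the integral is sqrt 2 * PI. For large E the bound
psi E t <= (max (0, E sin t) + 2) phi (E cos t) with phi v = v / sqrt (exp (v^2) - 1),
whose primitive is atan (sqrt (exp (v^2) - 1)), shows that the limit is at most PI. The
intermediate value theorem gives a. Finally the moving frame shows that translation by one
period is a rotation by Lambda_p(a) about the axis, which yields the closing statement. *)

Require Import Defs.
From Stdlib Require Import Reals Arith Lra Lia ZArith ClassicalEpsilon.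
From Coquelicot Require Import Coquelicot.
Open Scope R_scope.

(** * Signed square roots of functions with a nondegenerate minimum *)

(** As an integral over [beta < k < alpha], Lambda is singular at both ends, and its interval moves
    with [a] and collapses as [a] tends to [a_star p]; continuity and limits are hard to read off
    there. The phase form has a fixed interval and a continuous integrand for every radius. The
    energy separates because dividing [z^2 + z'^2 + nu^2 = 1] by [nu^2] gives
    [(1 - y) / nu^2 = 1 + w^2], and [nu^2] is a constant times [y] to the power [- p / (1 - p)]:
    after a logarithm one summand depends on [y] and the other on [w]. The closing statement
    concerns every curve with [is_gamma_a], so the phase motion is rebuilt from an arbitrary such
    curve. Uniqueness theorems for differential equations are avoided: a rotation is recognised by
    turning it back to a constant, and autonomy is expressed by an explicit elapsed time as a
    function of the phase. Minimality of [rho] excludes several turns per period. *)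

Lemma is_derive_zero_const (f : R -> R) :
  (forall s, is_derive f s 0) -> forall s t, f s = f t.
Proof.
  intros Hf s t.
  destruct (MVT_gen f t s (fun _ => 0)) as [c [_ Hc]].
  - intros; apply Hf.
  - intros x _. apply derivable_continuous_pt.
    exists 0. apply is_derive_Reals, Hf.
  - lra.
Qed.

Lemma is_derive_to_eq (f : R -> R) (x l l' : R) : is_derive f x l -> l = l' -> is_derive f x l'.
Proof. now intros H <-. Qed.

Lemma is_derive_continuous (f : R -> R) (x l : R) : is_derive f x l -> continuous f x.
Proof. intros H. apply (ex_derive_continuous f). now exists l. Qed.

Ltac derive_with H :=
  match type of H with
  | is_derive ?f ?x ?l =>
      replace (Derive (fun t => f t) x) with l by (symmetry; apply (is_derive_unique f x l H))
  end.

Ltac split_and := repeat match goal with |- _ /\ _ => split end.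

Ltac ex_der :=
  split_and; try exact I;
  try match goal with
  | |- ex_derive (fun t => ?f t) _ =>
      match goal with H : context [is_derive f _ _] |- _ => eexists; apply H end
  end.

Lemma is_derive_pos_lt (D : R -> Prop) (f f' : R -> R) :
  (forall x y z, D x -> D z -> x <= y <= z -> D y) ->
  (forall y, D y -> is_derive f y (f' y)) -> (forall y, D y -> 0 < f' y) ->
  forall x y, D x -> D y -> x < y -> f x < f y.
Proof.
  intros Hc Hd Hp x y Hx Hy Hlt.
  destruct (MVT_cor2 f f' x y Hlt) as [c [Hc1 Hc2]].
  - intros c Hc0. apply is_derive_Reals, Hd, (Hc x c y); auto.
  - assert (0 < f' c) by (apply Hp, (Hc x c y); auto; lra).
    assert (0 < f' c * (y - x)) by (apply Rmult_lt_0_compat; lra). lra.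
Qed.

(** Turning the vector [(x, v)] back by the angle [Th s - Th 0] gives a constant vector. Used twice:
    for the phase of the profile and for the motion around the axis. *)
Lemma rotation_ode (x v om Th : R -> R) :
  (forall s, is_derive x s (om s * v s)) ->
  (forall s, is_derive v s (- om s * x s)) ->
  (forall s, is_derive Th s (om s)) ->
  forall s, x s = x 0 * cos (Th s - Th 0) + v 0 * sin (Th s - Th 0) /\
            v s = v 0 * cos (Th s - Th 0) - x 0 * sin (Th s - Th 0).
Proof.
  intros Hx Hv HT s.
  set (D := fun s => Th s - Th 0).
  assert (A : forall s, x s * cos (D s) - v s * sin (D s) = x 0 /\
              x s * sin (D s) + v s * cos (D s) = v 0).
  { intros t. split.
    - rewrite (is_derive_zero_const (fun s => x s * cos (D s) - v s * sin (D s)) ) with (t := 0).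
      + unfold D. rewrite Rminus_diag, cos_0, sin_0. ring.
      + intros u. unfold D. auto_derive.
        * ex_der.
        * derive_with (Hx u). derive_with (Hv u). derive_with (HT u).
          ring.
    - rewrite (is_derive_zero_const (fun s => x s * sin (D s) + v s * cos (D s)) ) with (t := 0).
      + unfold D. rewrite Rminus_diag, cos_0, sin_0. ring.
      + intros u. unfold D. auto_derive.
        * ex_der.
        * derive_with (Hx u). derive_with (Hv u). derive_with (HT u).
          ring. }
  destruct (A s) as [A1 A2]. fold (D s).
  pose proof (sin2_cos2 (D s)) as S. unfold Rsqr in S.
  rewrite <- A1, <- A2. split.
  - transitivity (x s * (sin (D s) * sin (D s) + cos (D s) * cos (D s))); [rewrite S|]; ring.
  - transitivity (v s * (sin (D s) * sin (D s) + cos (D s) * cos (D s))); [rewrite S|]; ring.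
Qed.

(** Near a zero minimum with [f' = (y - p) k], [f] behaves like [k p / 2 * (y - p)^2]; the value at
    [p] is therefore the continuous extension of the quotient. *)
Definition slope (f k : R -> R) (p y : R) : R :=
  if Req_EM_T y p then sqrt (k p / 2) else sqrt (f y) / Rabs (y - p).

Definition sroot (f k : R -> R) (p y : R) : R := (y - p) * slope f k p y.

(** Nondegeneracy is encoded by factoring the derivative with a positive continuous [k], so no
    second derivative of [f] is mentioned. Convexity of [D] keeps mean value points inside [D]. *)
Record quad_min (D : R -> Prop) (f k : R -> R) (p : R) : Prop := {
  qm_center : D p;
  qm_open : forall y, D y -> locally y D;
  qm_conv : forall x y z, D x -> D z -> x <= y <= z -> D y;
  qm_zero : f p = 0;
  qm_derive : forall y, D y -> is_derive f y ((y - p) * k y);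
  qm_cont : forall y, D y -> continuous k y;
  qm_pos : forall y, D y -> 0 < k y }.

Section QuadMin.
Context (D : R -> Prop) (f k : R -> R) (p : R) (Q : quad_min D f k p).

(* Rolle for [f t (y - p)^2 - f y (t - p)^2], which vanishes at [p] and [y]. *)
Lemma quad_min_taylor (y : R) : D y -> y <> p ->
  exists xi, D xi /\ Rabs (xi - p) < Rabs (y - p) /\ f y = k xi / 2 * (y - p) ^ 2.
Proof.
  intros Hy Hn. destruct Q as [Q1 Q2 Q3 Q4 Q5 Q6 Q7].
  set (g := fun t => f t * (y - p) ^ 2 - f y * (t - p) ^ 2).
  assert (Hg : forall t, D t -> derivable_pt_lim g t ((t - p) * (k t * (y - p) ^ 2 - 2 * f y))).
  { intros t Ht. apply is_derive_Reals. unfold g. auto_derive.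
    - eexists; apply (Q5 t Ht).
    - derive_with (Q5 t Ht). ring. }
  assert (Hgp : g p = 0) by (unfold g; rewrite Q4; ring).
  assert (Hgy : g y = 0) by (unfold g; ring).
  assert (Hfin : forall xi, xi <> p -> (xi - p) * (k xi * (y - p) ^ 2 - 2 * f y) = 0 ->
     f y = k xi / 2 * (y - p) ^ 2).
  { intros xi Hxi Hz. apply Rmult_integral in Hz. destruct Hz; lra. }
  destruct (Rlt_or_le p y) as [Hlt|Hle].
  - destruct (MVT_cor2 g (fun t => (t - p) * (k t * (y - p) ^ 2 - 2 * f y)) p y Hlt) as [xi [E1 E2]].
    { intros c Hc. apply Hg, (Q3 p c y); auto. }
    exists xi. split; [apply (Q3 p xi y); auto; lra|]. split; [rewrite !Rabs_pos_eq; lra|].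
    apply Hfin; [lra|]. rewrite Hgp, Hgy in E1. symmetry in E1.
    replace (0 - 0) with 0 in E1 by ring. apply Rmult_integral in E1. destruct E1; lra.
  - assert (Hlt : y < p) by lra.
    destruct (MVT_cor2 g (fun t => (t - p) * (k t * (y - p) ^ 2 - 2 * f y)) y p Hlt) as [xi [E1 E2]].
    { intros c Hc. apply Hg, (Q3 y c p); auto. }
    exists xi. split; [apply (Q3 y xi p); auto; lra|]. split; [rewrite !Rabs_left; lra|].
    apply Hfin; [lra|]. rewrite Hgp, Hgy in E1. symmetry in E1.
    replace (0 - 0) with 0 in E1 by ring. apply Rmult_integral in E1. destruct E1; lra.
Qed.

(** One formula covers [y = p] and [y <> p], so positivity of the slope and its continuity at [p]
    both follow from the properties of [k]. *)
Lemma slope_mean (y : R) : D y ->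
  exists xi, D xi /\ Rabs (xi - p) <= Rabs (y - p) /\ slope f k p y = sqrt (k xi / 2).
Proof.
  intros Hy. unfold slope. destruct (Req_EM_T y p) as [->|Hn].
  - exists p. split; [apply Q|]. split; [lra|reflexivity].
  - destruct (quad_min_taylor y Hy Hn) as [xi [H1 [H2 H3]]].
    exists xi. split; [easy|]. split; [lra|].
    pose proof (qm_pos _ _ _ _ Q xi H1).
    rewrite H3, sqrt_mult, <- Rsqr_pow2, sqrt_Rsqr_abs; try lra.
    + field. apply Rabs_no_R0. lra.
    + apply pow2_ge_0.
Qed.

Lemma slope_pos (y : R) : D y -> 0 < slope f k p y.
Proof.
  intros Hy. destruct (slope_mean y Hy) as [xi [H1 [_ ->]]].
  apply sqrt_lt_R0. pose proof (qm_pos _ _ _ _ Q xi H1). lra.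
Qed.

Lemma quad_min_ge0 (y : R) : D y -> 0 <= f y.
Proof.
  intros Hy. destruct (Req_EM_T y p) as [->|Hn].
  - rewrite (qm_zero _ _ _ _ Q). lra.
  - destruct (quad_min_taylor y Hy Hn) as [xi [H1 [H2 ->]]].
    pose proof (qm_pos _ _ _ _ Q xi H1).
    apply Rmult_le_pos; [lra|apply pow2_ge_0].
Qed.

Lemma sroot_sq (y : R) : D y -> sroot f k p y ^ 2 = f y.
Proof.
  intros Hy. unfold sroot, slope. destruct (Req_EM_T y p) as [->|Hn].
  - rewrite (qm_zero _ _ _ _ Q). ring.
  - replace (((y - p) * (sqrt (f y) / Rabs (y - p))) ^ 2)
      with ((sqrt (f y)) ^ 2 * ((y - p) ^ 2 / (Rabs (y - p)) ^ 2)) by (field; apply Rabs_no_R0; lra).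
    rewrite pow2_sqrt by now apply quad_min_ge0.
    rewrite pow2_abs. field. lra.
Qed.

Lemma slope_continuous (y : R) : D y -> continuous (slope f k p) y.
Proof.
  intros Hy. destruct (Req_EM_T y p) as [->|Hn].
  - assert (Hc : continuous (fun t => sqrt (k t / 2)) p).
    { apply (continuous_comp (fun t => k t / 2) sqrt).
      - apply (continuous_mult k (fun _ => / 2)); [now apply Q|apply continuous_const].
      - apply continuous_sqrt. }
    intros P HP.
    assert (E : slope f k p p = sqrt (k p / 2)).
    { unfold slope. destruct (Req_EM_T p p); [easy|now elim n]. }
    rewrite E in HP. specialize (Hc P HP).
    (* [e1] serves the continuity of [sqrt (k / 2)], [e2] keeps [t] in [D]. The mean value point is
       no farther from [p] than [t], so it also lies in the ball of radius [e1]. *)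
    destruct Hc as [e1 He1]. destruct (qm_open _ _ _ _ Q p Hy) as [e2 He2].
    exists (mkposreal _ (Rmin_pos e1 e2 (cond_pos e1) (cond_pos e2))).
    intros t Ht. unfold ball in Ht; simpl in Ht. unfold AbsRing_ball, abs, minus, plus, opp in Ht; simpl in Ht.
    fold (t - p) in Ht.
    pose proof (Rmin_l e1 e2). pose proof (Rmin_r e1 e2).
    destruct (slope_mean t) as [xi [H1 [H2 ->]]].
    + apply He2. unfold ball; simpl. unfold AbsRing_ball, abs, minus, plus, opp; simpl. unfold Rminus in *; lra.
    + apply He1. unfold ball; simpl. unfold AbsRing_ball, abs, minus, plus, opp; simpl. unfold Rminus in *; lra.
  - apply (continuous_ext_loc _ (fun t => sqrt (f t) / Rabs (t - p))).
    + assert (He : 0 < Rabs (y - p)) by (apply Rabs_pos_lt; lra).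
      exists (mkposreal _ He). intros t Ht.
      unfold ball in Ht; simpl in Ht. unfold AbsRing_ball, abs, minus, plus, opp in Ht; simpl in Ht.
      unfold slope. destruct (Req_EM_T t p) as [->|]; [|easy].
      rewrite <- Rabs_Ropp in Ht. replace (- (p + - y)) with (y - p) in Ht by ring. lra.
    + apply (continuous_mult (fun t => sqrt (f t)) (fun t => / Rabs (t - p))).
      * apply (continuous_comp f sqrt); [|apply continuous_sqrt].
        eapply is_derive_continuous, Q, Hy.
      * apply (continuous_comp (fun t => Rabs (t - p)) Rinv).
        -- apply (continuous_comp (fun t => t - p) Rabs); [|apply continuous_Rabs].
           apply (continuous_minus (fun t => t) (fun _ => p)); [apply continuous_id|apply continuous_const].
        -- apply continuous_Rinv. apply Rabs_no_R0. lra.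
Qed.

(** At [p] the difference quotient is the slope itself, and [slope^2 = k p / 2] there makes the
    formula agree; elsewhere the signed root is locally a fixed sign times [sqrt f]. *)
Lemma sroot_derive (y : R) : D y -> is_derive (sroot f k p) y (k y / (2 * slope f k p y)).
Proof.
  intros Hy. pose proof (slope_pos y Hy) as Hs.
  destruct (Req_EM_T y p) as [->|Hn].
  - assert (E : k p / (2 * slope f k p p) = slope f k p p).
    { assert (E : slope f k p p = sqrt (k p / 2)).
      { unfold slope. destruct (Req_EM_T p p); [easy|now elim n]. }
      pose proof (qm_pos _ _ _ _ Q p Hy).
      assert (slope f k p p * slope f k p p = k p / 2) by (rewrite E; apply sqrt_sqrt; lra).
      replace (k p) with (2 * (slope f k p p * slope f k p p)) by lra. field. lra. }
    rewrite E. apply is_derive_Reals. intros eps Heps.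
    destruct (slope_continuous p Hy (fun u => Rabs (u - slope f k p p) < eps)) as [d Hd].
    + exists (mkposreal _ Heps). intros u Hu. exact Hu.
    + exists d. intros h Hh Hhd. unfold sroot.
      replace (((p + h - p) * slope f k p (p + h) - (p - p) * slope f k p p) / h)
        with (slope f k p (p + h)) by (field; easy).
      apply Hd. unfold ball; simpl. unfold AbsRing_ball, abs, minus, plus, opp; simpl.
      now replace (p + h + - p) with h by ring.
  - assert (Hf : 0 < f y).
    { destruct (quad_min_taylor y Hy Hn) as [xi [H1 [H2 ->]]].
      pose proof (qm_pos _ _ _ _ Q xi H1).
      apply Rmult_lt_0_compat; [lra|]. rewrite <- Rsqr_pow2. apply Rsqr_pos_lt. lra. }
    set (sg := (y - p) / Rabs (y - p)).
    assert (He : 0 < Rabs (y - p)) by (apply Rabs_pos_lt; lra).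
    apply (is_derive_ext_loc (fun t => sg * sqrt (f t))).
    + exists (mkposreal _ He). intros t Ht.
      unfold ball in Ht; simpl in Ht. unfold AbsRing_ball, abs, minus, plus, opp in Ht; simpl in Ht.
      fold (t - y) in Ht.
      unfold sg, sroot, slope. destruct (Req_EM_T t p) as [->|Ht0]; [|symmetry].
      * rewrite <- Rabs_Ropp in Ht. replace (- (p - y)) with (y - p) in Ht by ring. lra.
      * destruct (Rlt_or_le p y).
        -- rewrite (Rabs_pos_eq (y - p)) in * by lra. apply Rabs_def2 in Ht.
           rewrite (Rabs_pos_eq (t - p)) by lra. apply Rminus_diag_uniq; field; lra.
        -- rewrite (Rabs_left (y - p)) in * by lra. apply Rabs_def2 in Ht.
           rewrite (Rabs_left (t - p)) by lra. apply Rminus_diag_uniq; field; lra.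
    + unfold slope. destruct (Req_EM_T y p) as [E|_]; [now elim Hn|].
      unfold sg. pose proof (qm_derive _ _ _ _ Q y Hy) as Hd.
      pose proof (sqrt_lt_R0 _ Hf).
      auto_derive.
      * split; [eexists; apply Hd|easy].
      * derive_with Hd.
        assert (Rabs (y - p) * Rabs (y - p) = (y - p) * (y - p)).
        { rewrite <- Rabs_mult. apply Rabs_pos_eq, Rle_0_sqr. }
        set (b := Rabs (y - p)) in *. set (c := y - p) in *.
        replace (k y / (2 * (sqrt (f y) / b))) with (k y * (b * b) / (2 * sqrt (f y) * b)) by (field; split; lra).
        rewrite H0. field. split; lra.
Qed.

Lemma sroot_incr (x y : R) : D x -> D y -> x < y -> sroot f k p x < sroot f k p y.
Proof.
  apply (is_derive_pos_lt D _ _ (qm_conv _ _ _ _ Q) sroot_derive).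
  intros t Ht. pose proof (slope_pos t Ht). pose proof (qm_pos _ _ _ _ Q t Ht).
  apply Rdiv_lt_0_compat; lra.
Qed.

Lemma sroot_inj (x y : R) : D x -> D y -> sroot f k p x = sroot f k p y -> x = y.
Proof.
  intros Hx Hy E. destruct (Rtotal_order x y) as [H|[H|H]]; [|easy|];
    apply sroot_incr in H; auto; lra.
Qed.

Lemma sroot_center : sroot f k p p = 0.
Proof. unfold sroot. ring. Qed.

End QuadMin.

(** * The two potentials *)

Lemma ln_le_sub1 (x : R) : 0 < x -> ln x <= x - 1.
Proof.
  intros Hx. pose proof (exp_ineq1_le (ln x)) as H. rewrite exp_ln in H; lra.
Qed.

Definition unit_itv (y : R) : Prop := 0 < y < 1.
Definition everywhere (y : R) : Prop := True.

Lemma unit_itv_open (y : R) : unit_itv y -> locally y unit_itv.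
Proof.
  intros [H0 H1].
  apply filter_and; [exact (open_gt 0 y H0)|exact (open_lt 1 y H1)].
Qed.

(* With y the squared height of the curve over the equator of its axis, the level sets of this potential are the level sets of y^(p/(1-p)) (1 - y), whose maximum is at y = p. *)
Definition pot (p y : R) : R := p / (1 - p) * ln (p / y) + ln ((1 - p) / (1 - y)).
Definition pot_k (p y : R) : R := / ((1 - p) * y * (1 - y)).

Lemma pot_quad_min (p : R) : 0 < p < 1 -> quad_min unit_itv (pot p) (pot_k p) p.
Proof.
  intros Hp. split; unfold unit_itv, pot, pot_k.
  - lra.
  - apply unit_itv_open.
  - intros; lra.
  - unfold Rdiv. rewrite !Rinv_r, ln_1 by lra. ring.
  - intros y Hy. auto_derive.
    + split_and; try lra; try exact I; apply Rdiv_lt_0_compat; lra.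
    + field. lra.
  - intros y Hy. apply (ex_derive_continuous (fun y => / ((1 - p) * y * (1 - y)))).
    auto_derive.
    apply Rgt_not_eq, Rlt_gt. repeat apply Rmult_lt_0_compat; lra.
  - intros y Hy. apply Rinv_0_lt_compat. repeat apply Rmult_lt_0_compat; lra.
Qed.

Definition lnsq (w : R) : R := ln (1 + w ^ 2).
Definition lnsq_k (w : R) : R := 2 / (1 + w ^ 2).

Lemma lnsq_quad_min : quad_min everywhere lnsq lnsq_k 0.
Proof.
  assert (H : forall w : R, 0 < 1 + w ^ 2) by (intros w; pose proof (pow2_ge_0 w); lra).
  split; unfold everywhere, lnsq, lnsq_k; try easy.
  - intros y _. exists (mkposreal 1 Rlt_0_1). easy.
  - replace (1 + 0 ^ 2) with 1 by ring. apply ln_1.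
  - intros y _. specialize (H y). auto_derive.
    + simpl in *; lra.
    + field. simpl in *; lra.
  - intros y _. specialize (H y). apply (ex_derive_continuous (fun w => 2 / (1 + w ^ 2))).
    auto_derive. simpl in *; lra.
  - intros y _. specialize (H y). apply Rdiv_lt_0_compat; lra.
Qed.

(** Solving [v^2 = ln (1 + w^2)] for [w^2] gives [expsq v]; its signed root is thus the inverse of
    the signed root of [lnsq]. *)
Definition expsq (v : R) : R := exp (v ^ 2) - 1.
Definition expsq_k (v : R) : R := 2 * exp (v ^ 2).

Lemma expsq_quad_min : quad_min everywhere expsq expsq_k 0.
Proof.
  split; unfold everywhere, expsq, expsq_k; try easy.
  - intros y _. exists (mkposreal 1 Rlt_0_1). easy.
  - replace (0 ^ 2) with 0 by ring. rewrite exp_0. ring.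
  - intros y _. auto_derive; [easy|]. simpl. ring.
  - intros y _. apply (ex_derive_continuous (fun v => 2 * exp (v ^ 2))).
    auto_derive. easy.
  - intros y _. pose proof (exp_pos (y ^ 2)). lra.
Qed.

Definition hslope (p y : R) : R := slope (pot p) (pot_k p) p y.
Definition hroot (p y : R) : R := sroot (pot p) (pot_k p) p y.
Definition lroot (w : R) : R := sroot lnsq lnsq_k 0 w.
Definition eroot (v : R) : R := sroot expsq expsq_k 0 v.
Definition eslope (v : R) : R := slope expsq expsq_k 0 v.
Definition lslope (w : R) : R := slope lnsq lnsq_k 0 w.

Lemma eslope_pos (v : R) : 0 < eslope v.
Proof. now apply (slope_pos _ _ _ _ expsq_quad_min). Qed.

Lemma lslope_pos (v : R) : 0 < lslope v.
Proof. now apply (slope_pos _ _ _ _ lnsq_quad_min). Qed.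

Lemma eslope_continuous (v : R) : continuous eslope v.
Proof. now apply (slope_continuous _ _ _ _ expsq_quad_min). Qed.

Lemma lroot_sq (w : R) : lroot w ^ 2 = ln (1 + w ^ 2).
Proof. now apply (sroot_sq _ _ _ _ lnsq_quad_min). Qed.

Lemma eroot_sq (w : R) : eroot w ^ 2 = exp (w ^ 2) - 1.
Proof. now apply (sroot_sq _ _ _ _ expsq_quad_min). Qed.

Lemma eroot_eq (v : R) : eroot v = v * eslope v.
Proof. unfold eroot, sroot, eslope. ring. Qed.

Lemma lroot_eq (v : R) : lroot v = v * lslope v.
Proof. unfold lroot, sroot, lslope. ring. Qed.

(** The positive factor [c] records that [a] and [b] have the same sign. *)
Lemma pow2_inj_sign (a b c : R) : 0 < c -> a ^ 2 = b ^ 2 -> a = b * c -> a = b.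
Proof.
  intros Hc H E. subst a.
  assert (H0 : b ^ 2 * ((c - 1) * (c + 1)) = 0) by (replace (b ^ 2 * ((c - 1) * (c + 1))) with ((b * c) ^ 2 - b ^ 2) by ring; lra).
  apply Rmult_integral in H0. destruct H0 as [H0|H0].
  - assert (b = 0) by (apply Rsqr_0_uniq; rewrite Rsqr_pow2; easy). subst; ring.
  - apply Rmult_integral in H0. destruct H0; [replace c with 1 by lra; ring|lra].
Qed.

Lemma eroot_lroot (w : R) : eroot (lroot w) = w.
Proof.
  apply (pow2_inj_sign _ _ (lslope w * eslope (lroot w))).
  - apply Rmult_lt_0_compat; [apply lslope_pos|apply eslope_pos].
  - rewrite eroot_sq, lroot_sq, exp_ln. ring. pose proof (pow2_ge_0 w); lra.
  - rewrite eroot_eq. set (e := eslope (lroot w)). rewrite lroot_eq. ring.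
Qed.

(** This is [eroot (lroot w) = w] divided by [w]; at 0, where division fails, both slopes have
    central value 1. *)
Lemma lslope_eslope (w : R) : lslope w * eslope (lroot w) = 1.
Proof.
  destruct (Req_EM_T w 0) as [->|Hn].
  - replace (lroot 0) with 0 by (rewrite lroot_eq; ring).
    unfold lslope, eslope, slope. destruct (Req_EM_T 0 0) as [_|H]; [|now elim H].
    unfold lnsq_k, expsq_k. rewrite <- sqrt_mult.
    + replace (0 ^ 2) with 0 by ring. rewrite exp_0.
      replace (2 / (1 + 0) / 2 * (2 * 1 / 2)) with 1 by field. apply sqrt_1.
    + replace (0 ^ 2) with 0 by ring. lra.
    + pose proof (exp_pos (0 ^ 2)). lra.
  - apply (Rmult_eq_reg_l w); [|easy].
    transitivity (eroot (lroot w)).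
    + rewrite eroot_eq. set (e := eslope (lroot w)). rewrite lroot_eq. ring.
    + rewrite eroot_lroot. ring.
Qed.

Lemma lroot_derive (w : R) : is_derive lroot w (/ ((1 + w ^ 2) * lslope w)).
Proof.
  eapply is_derive_to_eq.
  - now apply (sroot_derive _ _ _ _ lnsq_quad_min).
  - fold (lslope w). unfold lnsq_k. pose proof (lslope_pos w). pose proof (pow2_ge_0 w).
    field. lra.
Qed.

Lemma eroot_derive (v : R) : is_derive eroot v (exp (v ^ 2) / eslope v).
Proof.
  eapply is_derive_to_eq.
  - now apply (sroot_derive _ _ _ _ expsq_quad_min).
  - fold (eslope v). unfold expsq_k. pose proof (eslope_pos v). field. lra.
Qed.

(** Since [1 + eroot v ^ 2 = exp (v ^ 2)], the exponential in the derivative of [eroot] cancels. The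
    function [/ eslope] is the even extension of the weight phi, with value 1 at 0. *)
Lemma atan_eroot_derive (v : R) : is_derive (fun v => atan (eroot v)) v (/ eslope v).
Proof.
  pose proof (eroot_derive v) as H.
  auto_derive.
  - ex_der.
  - derive_with H. pose proof (eslope_pos v). pose proof (exp_pos (v ^ 2)).
    replace (eroot v * (eroot v * 1)) with (eroot v ^ 2) by ring.
    rewrite eroot_sq. field. lra.
Qed.

(** The square of [1 + x / 2 <= exp (x / 2)]. *)
Lemma exp_sq_lower (x : R) : 0 <= x -> 1 + x + x ^ 2 / 4 <= exp x.
Proof.
  intros Hx. replace x with (x / 2 + x / 2) at 3 by field. rewrite exp_plus.
  pose proof (exp_ineq1_le (x / 2)).
  replace (1 + x + x ^ 2 / 4) with ((1 + x / 2) * (1 + x / 2)) by field.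
  apply Rmult_le_compat; lra.
Qed.

(** The quadratic term of the lower bound for [exp (v^2)] gives [v^4 <= 4 * eroot v ^ 2], which is
    then divided by [v^2]. This makes the weight [/ eslope (E * cos t)] of order [1 / E] away from
    the zeros of the cosine. *)
Lemma eslope_lower (v : R) : Rabs v <= 2 * eslope v.
Proof.
  destruct (Req_EM_T v 0) as [->|Hn].
  - rewrite Rabs_R0. pose proof (eslope_pos 0). lra.
  - pose proof (eslope_pos v). apply Rsqr_incr_0; [|apply Rabs_pos|].
    + rewrite <- Rsqr_abs. unfold Rsqr.
      assert (0 < v * v) by (fold (Rsqr v); now apply Rsqr_pos_lt).
      apply (Rmult_le_reg_l (v * v)); [easy|].
      replace (v * v * (2 * eslope v * (2 * eslope v))) with (4 * eroot v ^ 2) by (rewrite eroot_eq; ring).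
      rewrite eroot_sq. pose proof (exp_sq_lower (v ^ 2) (pow2_ge_0 v)).
      replace (v * v * (v * v)) with ((v ^ 2) ^ 2) by ring.
      pose proof (pow2_ge_0 v). lra.
    + lra.
Qed.

(** * Bounds for the height potential and the inverse of its signed root *)

Section Height.
Context (p : R) (Hp : 0 < p < 1).

Lemma hslope_pos (y : R) : unit_itv y -> 0 < hslope p y.
Proof. apply (slope_pos _ _ _ _ (pot_quad_min p Hp)). Qed.

Lemma hroot_sq (y : R) : unit_itv y -> hroot p y ^ 2 = pot p y.
Proof. apply (sroot_sq _ _ _ _ (pot_quad_min p Hp)). Qed.

Lemma hroot_eq (y : R) : hroot p y = (y - p) * hslope p y.
Proof. easy. Qed.

(** Applying [ln u <= u - 1] to both logarithms of [pot] gives a bound that equals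
    [(y - p)^2 / ((1 - p) y (1 - y))] exactly. *)
Lemma hslope_sq_le (y : R) : unit_itv y -> hslope p y ^ 2 <= / ((1 - p) * y * (1 - y)).
Proof.
  intros Hy. pose proof Hy as Hy'. unfold unit_itv in Hy'.
  assert (Hpos : 0 < (1 - p) * y * (1 - y)) by (repeat apply Rmult_lt_0_compat; lra).
  destruct (Req_EM_T y p) as [->|Hn].
  - unfold hslope, slope. destruct (Req_EM_T p p) as [_|H]; [|now elim H].
    pose proof (Rinv_0_lt_compat _ Hpos). unfold pot_k.
    rewrite pow2_sqrt; lra.
  - assert (H2 : 0 < (y - p) ^ 2) by (rewrite <- Rsqr_pow2; apply Rsqr_pos_lt; lra).
    apply (Rmult_le_reg_l ((y - p) ^ 2)); [easy|].
    replace ((y - p) ^ 2 * hslope p y ^ 2) with (hroot p y ^ 2) by (rewrite hroot_eq; ring).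
    rewrite hroot_sq by easy. unfold pot.
    assert (A : ln (p / y) <= p / y - 1) by (apply ln_le_sub1, Rdiv_lt_0_compat; lra).
    assert (B : ln ((1 - p) / (1 - y)) <= (1 - p) / (1 - y) - 1) by (apply ln_le_sub1, Rdiv_lt_0_compat; lra).
    assert (0 < p / (1 - p)) by (apply Rdiv_lt_0_compat; lra).
    assert (p / (1 - p) * ln (p / y) <= p / (1 - p) * (p / y - 1)) by (apply Rmult_le_compat_l; lra).
    replace ((y - p) ^ 2 * / ((1 - p) * y * (1 - y)))
      with (p / (1 - p) * (p / y - 1) + ((1 - p) / (1 - y) - 1)) by (field; lra).
    lra.
Qed.

Lemma pow2_le_inv (a b : R) : 0 <= b -> a ^ 2 <= b ^ 2 -> a <= b.
Proof.
  intros Hb H. apply Rnot_lt_le. intros Hlt.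
  assert (0 < (a - b) * (a + b)) by (apply Rmult_lt_0_compat; lra).
  nra.
Qed.

Lemma sqrt_hslope_le (y : R) : unit_itv y ->
  (1 - p) * sqrt y * hslope p y <= Rmax 0 (hroot p y) + 2.
Proof.
  intros Hy. pose proof Hy as Hy'. unfold unit_itv in Hy'.
  pose proof (hslope_pos y Hy) as Hs. pose proof (hslope_sq_le y Hy) as Hsq.
  (* Up to the midpoint of [p] and 1, [1 - y] is at least [(1 - p) / 2] and the square of the left
     side is at most [(1 - p) / (1 - y) <= 2]. Beyond it [1 - p] splits as [(y - p) + (1 - y)]: the
     first part yields [hroot], and in the second the factor [1 - y] tames the blow-up of the slope
     at 1. *)
  destruct (Rle_lt_dec y ((1 + p) / 2)) as [Hc|Hc].
  - pose proof (Rmax_l 0 (hroot p y)).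
    enough ((1 - p) * sqrt y * hslope p y <= 2) by lra.
    apply pow2_le_inv; [lra|].
    replace (((1 - p) * sqrt y * hslope p y) ^ 2) with ((1 - p) ^ 2 * sqrt y ^ 2 * hslope p y ^ 2) by ring.
    rewrite pow2_sqrt by lra.
    apply Rle_trans with ((1 - p) ^ 2 * y * / ((1 - p) * y * (1 - y))).
    + apply Rmult_le_compat_l; [|easy]. apply Rmult_le_pos; [apply pow2_ge_0|lra].
    + replace ((1 - p) ^ 2 * y * / ((1 - p) * y * (1 - y))) with ((1 - p) / (1 - y)) by (field; lra).
      apply (Rmult_le_reg_r (1 - y)); [lra|]. replace ((1 - p) / (1 - y) * (1 - y)) with (1 - p) by (field; lra).
      lra.
  - pose proof (Rmax_r 0 (hroot p y)).
    enough ((1 - p) * sqrt y * hslope p y <= hroot p y + 2) by lra.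
    assert (sqrt y <= 1) by (rewrite <- sqrt_1; apply sqrt_le_1; lra).
    apply Rle_trans with ((1 - p) * hslope p y).
    + apply Rmult_le_compat_r; [lra|]. rewrite <- (Rmult_1_r (1 - p)) at 2. apply Rmult_le_compat_l; lra.
    + rewrite hroot_eq.
      enough (hslope p y * (1 - y) <= 2) by lra.
      apply pow2_le_inv; [lra|].
      replace ((hslope p y * (1 - y)) ^ 2) with ((1 - y) ^ 2 * hslope p y ^ 2) by ring.
      apply Rle_trans with ((1 - y) ^ 2 * / ((1 - p) * y * (1 - y))).
      * apply Rmult_le_compat_l; [|easy]. apply pow2_ge_0.
      * replace ((1 - y) ^ 2 * / ((1 - p) * y * (1 - y))) with ((1 - y) / ((1 - p) * y)) by (field; lra).
        assert (0 < (1 - p) * y) by (apply Rmult_lt_0_compat; lra).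
        apply (Rmult_le_reg_r ((1 - p) * y)); [lra|].
        replace ((1 - y) / ((1 - p) * y) * ((1 - p) * y)) with (1 - y) by (field; lra).
        nra.
Qed.

Lemma pot_unbounded (h : R) : 0 <= h ->
  (exists y, p < y < 1 /\ h <= pot p y) /\ (exists y, 0 < y < p /\ h <= pot p y).
Proof.
  intros Hh.
  assert (Hq : 0 < p / (1 - p)) by (apply Rdiv_lt_0_compat; lra).
  assert (L1 : ln p < 0) by (rewrite <- ln_1; apply ln_increasing; lra).
  assert (L2 : ln (1 - p) < 0) by (rewrite <- ln_1; apply ln_increasing; lra).
  split.
  (* With the witness below, [ln ((1 - p) / (1 - y)) = c]; the other summand of [pot] exceeds
     [p / (1 - p) * ln p], the amount added in advance. *)
  - set (c := h - p / (1 - p) * ln p).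
    assert (Hc : 0 < c) by (unfold c; assert (0 < p / (1 - p) * - ln p) by (apply Rmult_lt_0_compat; lra); lra).
    assert (He : exp (- c) < 1) by (rewrite <- exp_0; apply exp_increasing; lra).
    pose proof (exp_pos (- c)).
    exists (1 - (1 - p) * exp (- c)). split; [nra|]. unfold pot.
    replace (1 - (1 - (1 - p) * exp (- c))) with ((1 - p) * exp (- c)) by ring.
    replace ((1 - p) / ((1 - p) * exp (- c))) with (/ exp (- c)) by (field; split; lra).
    rewrite <- exp_Ropp, Ropp_involutive, ln_exp.
    set (y := 1 - (1 - p) * exp (- c)).
    assert (0 < y < 1) by (unfold y; nra).
    assert (ln y < 0) by (rewrite <- ln_1; apply ln_increasing; lra).
    rewrite ln_div by lra. unfold c.
    assert (0 < p / (1 - p) * - ln y) by (apply Rmult_lt_0_compat; lra). lra.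
  (* Here the first summand of [pot] at [p * exp (- c)] is [h - ln (1 - p)], and the second is at
     least [ln (1 - p)]. *)
  - set (c := (h - ln (1 - p)) / (p / (1 - p))).
    assert (Hc : 0 < c) by (apply Rdiv_lt_0_compat; lra).
    assert (He : exp (- c) < 1) by (rewrite <- exp_0; apply exp_increasing; lra).
    pose proof (exp_pos (- c)).
    exists (p * exp (- c)). split; [nra|]. unfold pot.
    replace (p / (p * exp (- c))) with (/ exp (- c)) by (field; split; lra).
    rewrite <- exp_Ropp, Ropp_involutive, ln_exp.
    replace (p / (1 - p) * c) with (h - ln (1 - p)) by (unfold c; field; lra).
    set (y := p * exp (- c)).
    assert (0 < y < p) by (unfold y; nra).
    assert (ln (1 - y) < 0) by (rewrite <- ln_1; apply ln_increasing; lra).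
    rewrite ln_div by lra. lra.
Qed.

Lemma hroot_continuous (y : R) : unit_itv y -> continuous (hroot p) y.
Proof. intros Hy. eapply is_derive_continuous, (sroot_derive _ _ _ _ (pot_quad_min p Hp)), Hy. Qed.

Lemma hroot_incr (x y : R) : unit_itv x -> unit_itv y -> x < y -> hroot p x < hroot p y.
Proof. apply (sroot_incr _ _ _ _ (pot_quad_min p Hp)). Qed.

Lemma hroot_inj (x y : R) : unit_itv x -> unit_itv y -> hroot p x = hroot p y -> x = y.
Proof. apply (sroot_inj _ _ _ _ (pot_quad_min p Hp)). Qed.

Lemma hroot_derive (y : R) : unit_itv y ->
  is_derive (hroot p) y (/ (2 * (1 - p) * y * (1 - y) * hslope p y)).
Proof.
  intros Hy. pose proof (hslope_pos y Hy). unfold unit_itv in *.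
  eapply is_derive_to_eq.
  - now apply (sroot_derive _ _ _ _ (pot_quad_min p Hp)).
  - fold (hslope p y). unfold pot_k. field. lra.
Qed.

Lemma hroot_surj (h : R) : exists y, unit_itv y /\ hroot p y = h.
Proof.
  pose proof (pow2_ge_0 h).
  (* The surplus 1 makes [hroot] exceed [h] in absolute value strictly at both ends; with opposite
     signs there, the intermediate value theorem applies. *)
  destruct (pot_unbounded (h ^ 2 + 1) ltac:(lra)) as [[y2 [Hy2 E2]] [y1 [Hy1 E1]]].
  assert (U1 : unit_itv y1) by (unfold unit_itv; lra).
  assert (U2 : unit_itv y2) by (unfold unit_itv; lra).
  assert (Up : unit_itv p) by (unfold unit_itv; lra).
  rewrite <- hroot_sq in E1, E2 by easy.
  pose proof (hroot_incr y1 p U1 Up ltac:(lra)) as I1.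
  pose proof (hroot_incr p y2 Up U2 ltac:(lra)) as I2.
  assert (E0 : hroot p p = 0) by apply sroot_center. rewrite E0 in *.
  destruct (Ranalysis5.IVT_interv (fun y => hroot p y - h) y1 y2) as [c [Hc1 Hc2]].
  - intros y Hy. apply continuity_pt_minus; [|apply continuity_pt_const; now intros ? ?].
    apply continuity_pt_filterlim, hroot_continuous. unfold unit_itv; lra.
  - lra.
  - nra.
  - nra.
  - exists c. split; [unfold unit_itv|]; lra.
Qed.

Definition hinv (h : R) : R :=
  epsilon (inhabits 0) (fun y => unit_itv y /\ hroot p y = h).

Lemma hinv_unit (h : R) : unit_itv (hinv h).
Proof. apply (epsilon_spec (inhabits 0) _ (hroot_surj h)). Qed.

Lemma hroot_hinv (h : R) : hroot p (hinv h) = h.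
Proof. apply (epsilon_spec (inhabits 0) _ (hroot_surj h)). Qed.

Lemma hinv_hroot (y : R) : unit_itv y -> hinv (hroot p y) = y.
Proof. intros Hy. apply hroot_inj; [apply hinv_unit|easy|apply hroot_hinv]. Qed.

Lemma hinv_lt (h : R) (y : R) : unit_itv y -> h < hroot p y -> hinv h < y.
Proof.
  intros Hy Hlt. destruct (Rtotal_order (hinv h) y) as [H|[H|H]]; [easy| |].
  - rewrite <- H, hroot_hinv in Hlt. lra.
  - apply hroot_incr in H; [|easy|apply hinv_unit]. rewrite hroot_hinv in H. lra.
Qed.

Lemma hinv_gt (h : R) (y : R) : unit_itv y -> hroot p y < h -> y < hinv h.
Proof.
  intros Hy Hlt. destruct (Rtotal_order (hinv h) y) as [H|[H|H]]; [| |easy].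
  - apply hroot_incr in H; [|apply hinv_unit|easy]. rewrite hroot_hinv in H. lra.
  - rewrite <- H, hroot_hinv in Hlt. lra.
Qed.

(** The inverse of a strictly increasing function onto the line: [t] between [hroot p (y - d)] and
    [hroot p (y + d)] has its preimage within [d] of [y]. *)
Lemma hinv_continuous (h : R) : continuous hinv h.
Proof.
  intros P [e He]. pose proof (hinv_unit h) as U. pose proof U as U'. unfold unit_itv in U'.
  set (y := hinv h) in *.
  set (d := Rmin (e / 2) (Rmin (y / 2) ((1 - y) / 2))).
  pose proof (cond_pos e).
  assert (Hd : 0 < d /\ d < e /\ d < y /\ d < 1 - y).
  { pose proof (Rmin_l (e / 2) (Rmin (y / 2) ((1 - y) / 2))).
    pose proof (Rmin_r (e / 2) (Rmin (y / 2) ((1 - y) / 2))).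
    pose proof (Rmin_l (y / 2) ((1 - y) / 2)). pose proof (Rmin_r (y / 2) ((1 - y) / 2)).
    assert (0 < d) by (unfold d; repeat apply Rmin_pos; lra).
    fold d in H0, H1. split_and; lra. }
  assert (U1 : unit_itv (y - d)) by (unfold unit_itv; lra).
  assert (U2 : unit_itv (y + d)) by (unfold unit_itv; lra).
  pose proof (hroot_incr (y - d) y U1 U ltac:(lra)) as I1.
  pose proof (hroot_incr y (y + d) U U2 ltac:(lra)) as I2.
  unfold y in I1, I2. rewrite hroot_hinv in I1, I2. fold y in I1, I2.
  assert (L : locally h (fun t => hroot p (y - d) < t /\ t < hroot p (y + d))).
  { apply filter_and; [exact (open_gt _ h I1)|exact (open_lt _ h I2)]. }
  change (locally h (fun t => P (hinv t))). revert L. apply filter_imp. intros t [T1 T2]. apply He.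
  apply hinv_gt in T1; [|easy]. apply hinv_lt in T2; [|easy].
  unfold ball; simpl. unfold AbsRing_ball, abs, minus, plus, opp; simpl.
  fold y. apply Rabs_def1; lra.
Qed.

Lemma hslope_hinv_continuous (h : R) : continuous (fun t => hslope p (hinv t)) h.
Proof.
  apply (continuous_comp hinv (hslope p)); [apply hinv_continuous|].
  apply (slope_continuous _ _ _ _ (pot_quad_min p Hp)), hinv_unit.
Qed.

End Height.

(** * The angular progression as a function of the radius *)

Lemma ex_RInt_cont (f : R -> R) (a b : R) : (forall t, continuous f t) -> ex_RInt f a b.
Proof. intros H. apply (ex_RInt_continuous f). intros; apply H. Qed.

Lemma RInt_derive_cont (f : R -> R) (a : R) :
  (forall t, continuous f t) -> forall t, is_derive (fun x => RInt f a x) t (f t).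
Proof.
  intros H t. apply (is_derive_RInt f (fun x => RInt f a x) a t); [|apply H].
  exists (mkposreal 1 Rlt_0_1). intros u _. apply (RInt_correct f), ex_RInt_cont, H.
Qed.

(** The derivative in [c] is [f (c + T) - f c = 0]. *)
Lemma RInt_periodic (f : R -> R) (T : R) :
  (forall t, continuous f t) -> (forall t, f (t + T) = f t) ->
  forall c, RInt f c (c + T) = RInt f 0 T.
Proof.
  intros Hc HT c.
  assert (E : forall c, RInt f c (c + T) = RInt f 0 (c + T) - RInt f 0 c).
  { intros u. pose proof (RInt_Chasles f 0 u (u + T) (ex_RInt_cont _ _ _ Hc) (ex_RInt_cont _ _ _ Hc)) as H.
    unfold plus in H; simpl in H. lra. }
  rewrite (E c).
  rewrite (is_derive_zero_const (fun c => RInt f 0 (c + T) - RInt f 0 c)) with (t := 0).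
  - rewrite RInt_point. unfold zero; simpl. rewrite Rplus_0_l. ring.
  - intros s. apply is_derive_to_eq with (f (s + T) - f s); [|rewrite HT; ring].
    apply (is_derive_minus (fun c => RInt f 0 (c + T)) (fun c => RInt f 0 c)).
    + pose proof (is_derive_comp (fun x => RInt f 0 x) (fun c => c + T) s (f (s + T)) 1) as H.
      replace (f (s + T)) with (scal 1 (f (s + T))) by apply Rmult_1_l.
      apply H; [now apply RInt_derive_cont|]. auto_derive; [easy|ring].
    + now apply RInt_derive_cont.
Qed.

Section Angle.
Context (p : R) (Hp : 0 < p < 1).

(** The part of [psi] depending on the height alone. It arises by dividing the angular speed
    [nu / (1 - z^2)] about the axis by the speed of the phase, where [nu] and [1 - z^2] cancel. *)
Definition amp (h : R) : R := (1 - p) * sqrt (hinv p h) * hslope p (hinv p h).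

(* Angle travelled around the axis per unit of phase, at phase [t] on the level set of radius [E]. *)
Definition psi (E t : R) : R := amp (E * sin t) / eslope (E * cos t).

Definition Lam (E : R) : R := RInt (psi E) 0 (2 * PI).

Lemma amp_continuous (h : R) : continuous amp h.
Proof.
  unfold amp.
  apply (continuous_mult (fun h => (1 - p) * sqrt (hinv p h)) (fun h => hslope p (hinv p h))).
  - apply (continuous_mult (fun _ => 1 - p) (fun h => sqrt (hinv p h))); [apply continuous_const|].
    apply (continuous_comp (hinv p) sqrt); [now apply hinv_continuous|apply continuous_sqrt].
  - now apply hslope_hinv_continuous.
Qed.

Lemma amp_le (h : R) : amp h <= Rmax 0 h + 2.
Proof.
  unfold amp. pose proof (sqrt_hslope_le p Hp (hinv p h) (hinv_unit p Hp h)) as H.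
  now rewrite hroot_hinv in H.
Qed.

Lemma psi_continuous2 (E t : R) :
  continuous (fun z : R * R => psi (fst z) (snd z)) (E, t).
Proof.
  unfold psi.
  assert (C1 : continuous (fun z : R * R => fst z * sin (snd z)) (E, t)).
  { apply (continuous_mult (fun z : R * R => fst z) (fun z => sin (snd z))); [apply continuous_fst|].
    apply (continuous_comp (fun z : R * R => snd z) sin); [apply continuous_snd|apply continuous_sin]. }
  assert (C2 : continuous (fun z : R * R => fst z * cos (snd z)) (E, t)).
  { apply (continuous_mult (fun z : R * R => fst z) (fun z => cos (snd z))); [apply continuous_fst|].
    apply (continuous_comp (fun z : R * R => snd z) cos); [apply continuous_snd|apply continuous_cos]. }
  apply (continuous_mult (fun z : R * R => amp (fst z * sin (snd z))) (fun z => / eslope (fst z * cos (snd z)))).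
  - apply (continuous_comp _ amp); [easy|apply amp_continuous].
  - apply (continuous_comp (fun z : R * R => eslope (fst z * cos (snd z))) Rinv).
    + apply (continuous_comp _ eslope); [easy|apply eslope_continuous].
    + apply continuous_Rinv. apply Rgt_not_eq, eslope_pos.
Qed.

Lemma psi_continuous (E t : R) : continuous (psi E) t.
Proof.
  apply (continuous_comp_2 (fun _ : R => E) (fun t => t) psi).
  - apply continuous_const.
  - apply continuous_id.
  - apply psi_continuous2.
Qed.

Lemma psi_period (E t : R) : psi E (t + 2 * PI) = psi E t.
Proof.
  unfold psi. rewrite sin_plus, cos_plus, sin_2PI, cos_2PI.
  now rewrite !Rmult_0_r, !Rmult_1_r, Rplus_0_r, Rminus_0_r.
Qed.

Lemma eslope_even (v : R) : eslope (- v) = eslope v.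
Proof.
  unfold eslope, slope, expsq. destruct (Req_EM_T (- v) 0), (Req_EM_T v 0); try lra.
  replace ((- v) ^ 2) with (v ^ 2) by ring.
  replace (- v - 0) with (- (v - 0)) by ring. now rewrite Rabs_Ropp.
Qed.

Lemma psi_reflect (E t : R) : psi E (PI - t) = psi E t.
Proof.
  unfold psi. rewrite sin_PI_x.
  replace (cos (PI - t)) with (- cos t).
  - replace (E * - cos t) with (- (E * cos t)) by ring. now rewrite eslope_even.
  - rewrite cos_minus, cos_PI, sin_PI. ring.
Qed.

Lemma RInt_psi_period (E c : R) : RInt (psi E) c (c + 2 * PI) = Lam E.
Proof. apply RInt_periodic; [apply psi_continuous|apply psi_period]. Qed.

(** The reflection [t -> PI - t] keeps the height and reverses its derivative. On the half turn kept
    here the sine is injective, so [asin] recovers the phase from the curvature; the factor 2 is the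
    one in the definition of Lambda. *)
Lemma Lam_half (E : R) : Lam E = 2 * RInt (psi E) (- (PI / 2)) (PI / 2).
Proof.
  rewrite <- (RInt_psi_period E (- (PI / 2))).
  pose proof (ex_RInt_cont _ (- (PI / 2)) (PI / 2) (psi_continuous E)) as I1.
  pose proof (ex_RInt_cont _ (PI / 2) (- (PI / 2) + 2 * PI) (psi_continuous E)) as I2.
  rewrite <- (RInt_Chasles _ _ _ _ I1 I2).
  unfold plus; simpl.
  enough (RInt (psi E) (PI / 2) (- (PI / 2) + 2 * PI) = RInt (psi E) (- (PI / 2)) (PI / 2)) by lra.
  pose proof (RInt_comp_lin (psi E) (-1) PI (PI / 2) (- (PI / 2))) as H.
  replace (-1 * (PI / 2) + PI) with (PI / 2) in H by field.
  replace (-1 * (- (PI / 2)) + PI) with (- (PI / 2) + 2 * PI) in H by field.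
  rewrite <- H by easy.
  rewrite (RInt_ext _ (fun t => - psi E t)).
  - rewrite <- (opp_RInt_swap (psi E) (PI / 2) (- (PI / 2))) by (apply ex_RInt_swap; easy).
    apply (RInt_opp (psi E)). now apply ex_RInt_swap.
  - intros t _. unfold scal; simpl; unfold mult; simpl.
    replace (-1 * t + PI) with (PI - t) by ring. rewrite psi_reflect.
    apply Rminus_diag_uniq. ring.
Qed.

(** At radius 0 both slopes take their central values, [/ (sqrt (2 * p) * (1 - p))] and 1, so [p]
    cancels and [psi 0] is the constant [/ sqrt 2]. *)
Lemma Lam_0 : Lam 0 = sqrt 2 * PI.
Proof.
  unfold Lam.
  assert (E : forall t, psi 0 t = sqrt 2 / 2).
  { intros t. unfold psi. rewrite !Rmult_0_l.
    assert (E0 : hinv p 0 = p).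
    { rewrite <- (sroot_center (pot p) (pot_k p) p). apply hinv_hroot; [easy|exact Hp]. }
    unfold amp. rewrite E0. unfold hslope, eslope, slope.
    destruct (Req_EM_T p p) as [_|H]; [|now elim H].
    destruct (Req_EM_T 0 0) as [_|H]; [|now elim H].
    unfold pot_k, expsq_k. replace (0 ^ 2) with 0 by ring. rewrite exp_0.
    replace (2 * 1 / 2) with 1 by field. rewrite sqrt_1.
    assert (0 < p * (1 - p) ^ 2) by (apply Rmult_lt_0_compat; [lra|apply pow_lt; lra]).
    assert (0 < 2 * (p * (1 - p) ^ 2)) by lra.
    replace (/ ((1 - p) * p * (1 - p)) / 2) with (/ (2 * (p * (1 - p) ^ 2))) by (field; lra).
    rewrite sqrt_inv, !sqrt_mult, sqrt_pow2 by (try apply pow2_ge_0; lra).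
    pose proof (sqrt_lt_R0 2 ltac:(lra)). pose proof (sqrt_lt_R0 p ltac:(lra)).
    pose proof (sqrt_sqrt 2 ltac:(lra)).
    replace ((1 - p) * sqrt p * / (sqrt 2 * (sqrt p * (1 - p))) / 1) with (/ sqrt 2) by (field; lra).
    apply (Rmult_eq_reg_l (sqrt 2)); [|lra]. rewrite Rinv_r by lra. lra. }
  rewrite (RInt_ext _ (fun _ => sqrt 2 / 2)) by (intros; apply E).
  rewrite RInt_const. unfold scal; simpl; unfold mult; simpl. field.
Qed.

Lemma Lam_continuous (E : R) : continuous Lam E.
Proof.
  pose proof PI_RGT_0.
  intros P [e He].
  (* Multiplied by the length [2 * PI] this leaves [e / 2]. *)
  assert (He' : 0 < e / (4 * PI)) by (apply Rdiv_lt_0_compat; [apply cond_pos|lra]).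
  destruct (uniform_continuity_2d_1d' psi 0 (2 * PI) E) with (eps := mkposreal _ He') as [d Hd].
  { intros x _. apply continuity_2d_pt_filterlim. apply psi_continuous2. }
  exists d. intros u Hu. apply He.
  unfold ball in *; simpl in *. unfold AbsRing_ball, abs, minus, plus, opp in *; simpl in *.
  unfold Lam.
  pose proof (RInt_minus (psi u) (psi E) 0 (2 * PI) (ex_RInt_cont _ _ _ (psi_continuous u)) (ex_RInt_cont _ _ _ (psi_continuous E))) as H1.
  unfold minus, plus, opp in H1; simpl in H1. rewrite <- H1.
  apply Rle_lt_trans with ((2 * PI - 0) * (e / (4 * PI))).
  - apply abs_RInt_le_const; [lra| |].
    + apply (ex_RInt_minus (psi u) (psi E)); apply ex_RInt_cont, psi_continuous.
    + intros t Ht. apply Rlt_le. apply Rabs_def2 in Hu.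
      pose proof (cond_pos d).
      apply (Hd t E t u); auto; try lra.
      * unfold Rminus. rewrite Rplus_opp_r, Rabs_R0. apply cond_pos.
  - replace ((2 * PI - 0) * (e / (4 * PI))) with (e / 2) by (field; lra).
    pose proof (cond_pos e). lra.
Qed.

Lemma one_le_sin_cos (t : R) : 1 <= Rabs (sin t) + Rabs (cos t).
Proof.
  pose proof (sin2_cos2 t) as H. rewrite (Rsqr_abs (sin t)), (Rsqr_abs (cos t)) in H.
  unfold Rsqr in H. pose proof (Rabs_pos (sin t)). pose proof (Rabs_pos (cos t)). nra.
Qed.

(** The additive 2 in [amp_le] is spread over [2 |sin t| + 2 |cos t|]. The sine part keeps a weight
    with an explicit primitive, and [eslope_lower] bounds the cosine part by [4 / E]. *)
Lemma psi_le (E t : R) : 0 < E ->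
  psi E t <= (Rmax 0 (E * sin t) + 2 * Rabs (sin t)) / eslope (E * cos t) + 4 / E.
Proof.
  intros HE. unfold psi. pose proof (amp_le (E * sin t)) as H.
  pose proof (eslope_pos (E * cos t)) as Hs. pose proof (eslope_lower (E * cos t)) as Hl.
  pose proof (one_le_sin_cos t) as Ht.
  rewrite Rabs_mult, (Rabs_pos_eq E) in Hl by lra.
  apply Rle_trans with ((Rmax 0 (E * sin t) + 2 * Rabs (sin t) + 2 * Rabs (cos t)) / eslope (E * cos t)).
  - apply Rmult_le_compat_r; [apply Rlt_le, Rinv_0_lt_compat; lra|lra].
  - unfold Rdiv at 1. rewrite Rmult_plus_distr_r. apply Rplus_le_compat_l.
    apply (Rmult_le_reg_r (eslope (E * cos t) * E)); [apply Rmult_lt_0_compat; lra|].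
    replace (2 * Rabs (cos t) * / eslope (E * cos t) * (eslope (E * cos t) * E)) with (2 * (E * Rabs (cos t))) by (field; lra).
    replace (4 / E * (eslope (E * cos t) * E)) with (2 * (2 * eslope (E * cos t))) by (field; lra).
    lra.
Qed.

Lemma is_RInt_sin_eslope (E c d a b : R) : 0 < E ->
  is_RInt (fun t => c * (sin t / eslope (E * cos t)) + d) a b
   (c / E * (atan (eroot (E * cos a)) - atan (eroot (E * cos b))) + d * (b - a)).
Proof.
  intros HE.
  set (F := fun t => - c / E * atan (eroot (E * cos t)) + d * t).
  replace (c / E * (atan (eroot (E * cos a)) - atan (eroot (E * cos b))) + d * (b - a))
    with (minus (F b) (F a)) by (unfold F, minus, plus, opp; simpl; field; lra).
  apply (is_RInt_derive F (fun t => c * (sin t / eslope (E * cos t)) + d)).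
  - intros t _. unfold F.
    pose proof (is_derive_comp (fun v => atan (eroot v)) (fun t => E * cos t) t _ (- E * sin t) (atan_eroot_derive (E * cos t))) as H.
    unfold scal in H; simpl in H; unfold mult in H; simpl in H.
    assert (H' : is_derive (fun t => atan (eroot (E * cos t))) t (- E * sin t * / eslope (E * cos t))).
    { apply H. auto_derive; [easy|ring]. }
    pose proof (eslope_pos (E * cos t)).
    eapply is_derive_to_eq.
    + apply (is_derive_plus (fun t => - c / E * atan (eroot (E * cos t))) (fun t => d * t)).
      * apply is_derive_scal. apply H'.
      * apply is_derive_scal. apply is_derive_id.
    + unfold plus, one; simpl. field. lra.
  - intros t _. apply (continuous_plus (fun t => c * (sin t / eslope (E * cos t))) (fun _ => d)); [|apply continuous_const].
    apply (continuous_mult (fun _ => c) (fun t => sin t / eslope (E * cos t))); [apply continuous_const|].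
    apply (continuous_mult sin (fun t => / eslope (E * cos t))); [apply continuous_sin|].
    apply (continuous_comp (fun t => eslope (E * cos t)) Rinv); [|apply continuous_Rinv, Rgt_not_eq, eslope_pos].
    apply (continuous_comp (fun t => E * cos t) eslope); [|apply eslope_continuous].
    apply (continuous_mult (fun _ => E) cos); [apply continuous_const|apply continuous_cos].
Qed.

(** The leading [PI] bounds the variation of the arctangent on the half turn where the sine is
    positive. Of the error, [2 * PI / E] comes from the 2 in [amp_le] on each half turn and
    [4 * PI / E] from the cosine part on each. *)
Lemma Lam_le (E : R) : 0 < E -> Lam E <= PI + 12 * PI / E.
Proof.
  intros HE. pose proof PI_RGT_0 as HPI. unfold Lam.
  pose proof (ex_RInt_cont _ 0 PI (psi_continuous E)) as I1.
  pose proof (ex_RInt_cont _ PI (2 * PI) (psi_continuous E)) as I2.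
  rewrite <- (RInt_Chasles _ _ _ _ I1 I2). unfold plus; simpl.
  pose proof (is_RInt_sin_eslope E (E + 2) (4 / E) 0 PI HE) as J1.
  pose proof (is_RInt_sin_eslope E (-2) (4 / E) PI (2 * PI) HE) as J2.
  rewrite cos_0, cos_PI in J1. rewrite cos_PI, cos_2PI in J2.
  assert (A : RInt (psi E) 0 PI <= (E + 2) / E * (atan (eroot (E * 1)) - atan (eroot (E * -1))) + 4 / E * (PI - 0)).
  { rewrite <- (is_RInt_unique _ _ _ _ J1). apply RInt_le; [lra|easy|eexists; apply J1|].
    intros t Ht. pose proof (sin_gt_0 t ltac:(lra) ltac:(lra)) as Hs.
    pose proof (psi_le E t HE) as H. rewrite (Rabs_pos_eq (sin t)) in H by lra.
    rewrite Rmax_right in H by (apply Rmult_le_pos; lra).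
    replace ((E + 2) * (sin t / eslope (E * cos t))) with ((E * sin t + 2 * sin t) / eslope (E * cos t)); [easy|].
    unfold Rdiv; ring. }
  assert (B : RInt (psi E) PI (2 * PI) <= -2 / E * (atan (eroot (E * -1)) - atan (eroot (E * 1))) + 4 / E * (2 * PI - PI)).
  { rewrite <- (is_RInt_unique _ _ _ _ J2). apply RInt_le; [lra|easy|eexists; apply J2|].
    intros t Ht. pose proof (sin_lt_0 t ltac:(lra) ltac:(lra)) as Hs.
    pose proof (psi_le E t HE) as H. rewrite (Rabs_left (sin t)) in H by lra.
    rewrite Rmax_left in H by nra.
    replace (-2 * (sin t / eslope (E * cos t))) with ((0 + 2 * - sin t) / eslope (E * cos t)); [easy|].
    unfold Rdiv; ring. }
  pose proof (atan_bound (eroot (E * 1))). pose proof (atan_bound (eroot (E * -1))).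
  set (u := atan (eroot (E * 1)) - atan (eroot (E * -1))) in *.
  replace (atan (eroot (E * -1)) - atan (eroot (E * 1))) with (- u) in B by (unfold u; ring).
  assert (u <= PI) by (unfold u; lra).
  assert (Hi : 0 < / E) by now apply Rinv_0_lt_compat.
  replace ((E + 2) / E * u) with (u + 2 * (u * / E)) in A by (field; lra).
  replace (-2 / E * - u) with (2 * (u * / E)) in B by (field; lra).
  unfold Rdiv in *.
  assert (u * / E <= PI * / E) by (apply Rmult_le_compat_r; lra). lra.
Qed.

Lemma Lam_attains (v : R) : PI < v < sqrt 2 * PI -> exists E, 0 < E /\ Lam E = v.
Proof.
  intros Hv. pose proof PI_RGT_0 as HPI.
  (* Chosen so that the error [12 * PI / E1] is half of the gap [v - PI]. *)
  set (E1 := 24 * PI / (v - PI)).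
  assert (HE1 : 0 < E1) by (apply Rdiv_lt_0_compat; lra).
  assert (H1 : Lam E1 < v).
  { pose proof (Lam_le E1 HE1) as H.
    replace (12 * PI / E1) with ((v - PI) / 2) in H by (unfold E1; field; lra). lra. }
  destruct (IVT_gen_consistent Lam 0 E1 v) as [E [HE1' HE2]].
  - apply Lam_continuous.
  - rewrite Lam_0. rewrite Rmin_right, Rmax_left; lra.
  - exists E. split; [|easy]. rewrite Rmin_left in HE1' by lra.
    destruct (Req_EM_T E 0) as [->|]; [rewrite Lam_0 in HE2|]; lra.
Qed.

End Angle.

(** * Height and momentum *)

Lemma is_derive_Rpower (k e : R) : 0 < k ->
  is_derive (fun k => Rpower k e) k (e * Rpower k e / k).
Proof. intros Hk. unfold Rpower. auto_derive; [easy|]. field. lra. Qed.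

Lemma Rpower_pos (k e : R) : 0 < Rpower k e.
Proof. apply exp_pos. Qed.

Lemma a_star_pos (p : R) : 0 < a_star p.
Proof. apply Rmult_lt_0_compat; apply Rpower_pos. Qed.

Definition level (p E : R) : R := a_star p * exp ((1 - p) * E ^ 2).

(* Height over the equator of the axis and momentum of a curve of curvature [k], with first integral [a]. *)
Definition height (p a k : R) : R := p / (sqrt a * Rpower k (1 - p)).
Definition momentum (p a k : R) : R := (1 - p) * k / (sqrt a * Rpower k (1 - p)).

Lemma filterlim_asin_left : filterlim asin (at_left 1) (locally (PI / 2)).
Proof.
  pose proof PI_RGT_0 as HPI.
  intros P [e He]. pose proof (cond_pos e).
  set (d := Rmin (e / 2) (PI / 2)).
  assert (Hd : 0 < d) by (apply Rmin_pos; lra).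
  pose proof (Rmin_l (e / 2) (PI / 2)) as D1. pose proof (Rmin_r (e / 2) (PI / 2)) as D2. fold d in D1, D2.
  assert (Hs : sin (PI / 2 - d) < 1).
  { rewrite <- sin_PI2. apply sin_increasing_1; lra. }
  assert (Hs0 : 0 <= sin (PI / 2 - d)) by (apply sin_ge_0; lra).
  change (locally 1 (fun u => u < 1 -> P (asin u))).
  generalize (open_gt _ 1 Hs). apply filter_imp. intros u Hu Hu1. apply He.
  pose proof (asin_bound u) as Hb.
  assert (PI / 2 - d < asin u).
  { apply Rnot_le_lt. intros Hle.
    assert (sin (asin u) <= sin (PI / 2 - d)) by (apply sin_incr_1; lra).
    rewrite sin_asin in H0; lra. }
  unfold ball; simpl. unfold AbsRing_ball, abs, minus, plus, opp; simpl.
  apply Rabs_def1; lra.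
Qed.

Lemma filterlim_asin_right : filterlim asin (at_right (-1)) (locally (- (PI / 2))).
Proof.
  apply filterlim_ext with (fun u => - asin (- u)).
  { intros u. rewrite asin_opp. ring. }
  eapply filterlim_comp; [|apply (filterlim_opp (PI / 2))].
  eapply filterlim_comp; [|apply filterlim_asin_left].
  intros P HP. change (locally 1 (fun u => u < 1 -> P u)) in HP.
  change (locally (-1) (fun u => -1 < u -> P (- u))).
  pose proof (filterlim_opp (-1)) as H. unfold opp in H; simpl in H.
  replace (- -1) with 1 in H by ring. apply H in HP.
  change (locally (-1) (fun u => - u < 1 -> P (- u))) in HP.
  revert HP. apply filter_imp. intros u Hu Hu1. apply Hu. lra.
Qed.

Lemma is_derive_asin (x : R) : -1 < x < 1 -> is_derive asin x (/ sqrt (1 - x ^ 2)).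
Proof.
  intros Hx. apply is_derive_Reals.
  pose proof (derive_pt_asin x Hx) as H. apply derive_pt_eq_1 in H.
  replace (/ sqrt (1 - x ^ 2)) with (1 / sqrt (1 - x²)); [easy|].
  rewrite Rsqr_pow2. unfold Rdiv. ring.
Qed.

Section Level.
Context (p : R) (Hp : 0 < p < 1) (E : R) (HE : 0 < E).

Let a := level p E.

Lemma level_pos : 0 < level p E.
Proof. apply Rmult_lt_0_compat; [apply a_star_pos|apply exp_pos]. Qed.

Lemma level_gt : a_star p < level p E.
Proof.
  unfold level. rewrite <- (Rmult_1_r (a_star p)) at 1.
  apply Rmult_lt_compat_l; [apply a_star_pos|].
  apply Rle_lt_trans with (exp 0); [rewrite exp_0; lra|]. apply exp_increasing.
  apply Rmult_lt_0_compat; [lra|]. apply pow_lt; lra.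
Qed.

Lemma ln_level : ln a = p * ln p + (1 - p) * ln (1 - p) + (1 - p) * E ^ 2.
Proof.
  unfold a, level, a_star. rewrite ln_mult, ln_exp.
  - rewrite ln_mult by apply Rpower_pos. unfold Rpower. now rewrite !ln_exp.
  - apply a_star_pos.
  - apply exp_pos.
Qed.

Lemma sqrt_level_pos : 0 < sqrt a.
Proof. apply sqrt_lt_R0, level_pos. Qed.

Lemma sqrt_level_sq : sqrt a * sqrt a = a.
Proof. apply sqrt_sqrt, Rlt_le, level_pos. Qed.

Lemma height_pos (k : R) : 0 < height p a k.
Proof.
  apply Rdiv_lt_0_compat; [lra|]. apply Rmult_lt_0_compat; [apply sqrt_level_pos|apply Rpower_pos].
Qed.

Lemma momentum_pos (k : R) : 0 < k -> 0 < momentum p a k.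
Proof.
  intros Hk. apply Rdiv_lt_0_compat; [nra|]. apply Rmult_lt_0_compat; [apply sqrt_level_pos|apply Rpower_pos].
Qed.

Lemma ln_sqrt_level : ln (sqrt a) = ln a / 2.
Proof.
  pose proof sqrt_level_pos. rewrite <- sqrt_level_sq at 2.
  rewrite ln_mult by easy. field.
Qed.

Lemma ln_height (k : R) : 0 < k -> ln (height p a k) = ln p - (1 - p) * ln k - ln a / 2.
Proof.
  intros Hk. pose proof sqrt_level_pos. pose proof (Rpower_pos k (1 - p)).
  unfold height. rewrite ln_div; [|lra|now apply Rmult_lt_0_compat].
  rewrite ln_mult by easy. rewrite ln_sqrt_level. unfold Rpower. rewrite ln_exp. ring.
Qed.

Lemma ln_momentum (k : R) : 0 < k -> ln (momentum p a k) = ln (1 - p) + p * ln k - ln a / 2.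
Proof.
  intros Hk. pose proof sqrt_level_pos. pose proof (Rpower_pos k (1 - p)).
  unfold momentum. rewrite ln_div; [|nra|now apply Rmult_lt_0_compat].
  rewrite !ln_mult by lra. rewrite ln_sqrt_level. unfold Rpower. rewrite ln_exp. ring.
Qed.

Lemma ln_sq (x : R) : 0 < x -> ln (x ^ 2) = 2 * ln x.
Proof. intros Hx. simpl. rewrite Rmult_1_r, ln_mult by easy. ring. Qed.

(** The logarithms of height and momentum are affine in [ln k] with slopes [- (1 - p)] and [p], so
    [ln k] cancels, as does [ln (1 - y)]. The identity is algebraic in [k] and uses no differential
    equation. *)
Lemma energy (k : R) : 0 < k -> height p a k ^ 2 < 1 ->
  pot p (height p a k ^ 2) + ln ((1 - height p a k ^ 2) / momentum p a k ^ 2) = E ^ 2.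
Proof.
  intros Hk Hy. pose proof (height_pos k) as Hz. pose proof (momentum_pos k Hk) as Hn.
  unfold pot.
  rewrite !ln_div; try lra; try (apply pow_lt; lra).
  rewrite !ln_sq by easy. rewrite ln_height, ln_momentum by easy.
  rewrite ln_level. field. lra.
Qed.

Lemma Qpa_eq (k : R) : 0 < k ->
  Qpa p a k = a * Rpower k (1 - p) ^ 2 * (1 - height p a k ^ 2 - momentum p a k ^ 2).
Proof.
  intros Hk. unfold Qpa, height, momentum.
  replace (2 * (1 - p)) with ((1 - p) + (1 - p)) by ring. rewrite Rpower_plus.
  pose proof sqrt_level_pos. pose proof (Rpower_pos k (1 - p)).
  pose proof sqrt_level_sq as Hsq; set (r := sqrt a) in *; rewrite <- Hsq. field. lra.
Qed.

Lemma height_inj (k l : R) : 0 < k -> 0 < l -> height p a k ^ 2 = height p a l ^ 2 -> k = l.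
Proof.
  intros Hk Hl H. apply (f_equal ln) in H.
  rewrite !ln_sq, !ln_height in H by (try apply height_pos; easy).
  apply ln_inv; [easy..|]. apply (Rmult_eq_reg_l (1 - p)); lra.
Qed.

Lemma height_decr (k l : R) : 0 < k -> k < l -> height p a l ^ 2 < height p a k ^ 2.
Proof.
  intros Hk Hl. apply ln_lt_inv; try (apply pow_lt, height_pos).
  rewrite !ln_sq, !ln_height by (try apply height_pos; lra).
  assert (ln k < ln l) by (apply ln_increasing; lra). nra.
Qed.

Lemma height_surj (y : R) : 0 < y -> exists k, 0 < k /\ height p a k ^ 2 = y.
Proof.
  intros Hy. exists (exp ((ln p - ln a / 2 - ln y / 2) / (1 - p))).
  split; [apply exp_pos|].
  apply ln_inv; [apply pow_lt, height_pos|easy|].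
  rewrite ln_sq, ln_height by (try apply height_pos; apply exp_pos).
  rewrite ln_exp. field. lra.
Qed.

(** A zero of [Qpa] is a turning point, [1 - y = nu^2]; the logarithm in the energy then vanishes,
    so [pot] equals [E^2] and its signed root is [E] or [- E]. *)
Lemma Qpa_zero_hroot (k : R) : 0 < k ->
  (Qpa p a k = 0 <-> height p a k ^ 2 = hinv p E \/ height p a k ^ 2 = hinv p (- E)).
Proof.
  intros Hk. rewrite Qpa_eq by easy.
  pose proof (height_pos k) as Hz. pose proof (momentum_pos k Hk) as Hn.
  assert (0 < momentum p a k ^ 2) by (apply pow_lt; easy).
  assert (0 < height p a k ^ 2) by (apply pow_lt; easy).
  assert (0 < a * Rpower k (1 - p) ^ 2).
  { apply Rmult_lt_0_compat; [apply level_pos|apply pow_lt, Rpower_pos]. }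
  pose proof (energy k Hk) as He.
  set (y := height p a k ^ 2) in *. set (nu2 := momentum p a k ^ 2) in *.
  split.
  - intros H2. apply Rmult_integral in H2. destruct H2; [lra|].
    assert (Hy : unit_itv y) by (unfold unit_itv; lra).
    assert (Ey : hroot p y ^ 2 = E ^ 2).
    { rewrite hroot_sq by easy. rewrite <- He by lra.
      replace ((1 - y) / nu2) with 1 by (replace nu2 with (1 - y) by lra; field; lra).
      rewrite ln_1. ring. }
    assert (Ez : (hroot p y - E) * (hroot p y + E) = 0) by (replace ((hroot p y - E) * (hroot p y + E)) with (hroot p y ^ 2 - E ^ 2) by ring; lra).
    apply Rmult_integral in Ez. destruct Ez; [left|right]; rewrite <- (hinv_hroot p Hp y Hy); f_equal; lra.
  - intros H2.
    assert (Hy : unit_itv y) by (destruct H2 as [-> | ->]; now apply hinv_unit).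
    assert (Ey : hroot p y ^ 2 = E ^ 2).
    { destruct H2 as [-> | ->]; rewrite hroot_hinv by easy; ring. }
    unfold unit_itv in Hy. rewrite hroot_sq in Ey by easy. specialize (He ltac:(lra)).
    assert (L : ln ((1 - y) / nu2) = ln 1) by (rewrite ln_1; lra).
    apply ln_inv in L; [|apply Rdiv_lt_0_compat; lra|lra].
    assert (1 - y = nu2).
    { transitivity ((1 - y) / nu2 * nu2); [field; lra|rewrite L; ring]. }
    replace (1 - y - nu2) with 0 by lra. ring.
Qed.

Lemma is_derive_height_sq (k : R) : 0 < k ->
  is_derive (fun k => height p a k ^ 2) k (- (2 * (1 - p) * height p a k ^ 2 / k)).
Proof.
  intros Hk. unfold height. pose proof sqrt_level_pos. pose proof (Rpower_pos k (1 - p)).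
  pose proof (is_derive_Rpower k (1 - p) Hk) as Hd.
  auto_derive.
  - split_and; [eexists; apply Hd| |easy]. apply Rgt_not_eq. now apply Rmult_lt_0_compat.
  - replace (Derive (fun x : R => Rpower x (1 - p)) k) with ((1 - p) * Rpower k (1 - p) / k)
      by (symmetry; now apply is_derive_unique). field. lra.
Qed.

(** Change of variable from the curvature to the phase [asin (x / E)] of the half turn. Height
    decreases with curvature, hence the minus sign in front of the 2. *)
Lemma is_derive_phase (k : R) : 0 < k ->
  unit_itv (height p a k ^ 2) -> -E < hroot p (height p a k ^ 2) < E ->
  is_derive (fun k => -2 * RInt (psi p E) 0 (asin (hroot p (height p a k ^ 2) / E))) k
    (Lambda_integrand p a k) /\
  0 < Qpa p a k /\ 0 < a * Rpower k (2 * (1 - p)) - p ^ 2.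
Proof.
  intros Hk Hy Hx.
  pose proof (height_pos k) as Hz. pose proof (momentum_pos k Hk) as Hn.
  pose proof (energy k Hk) as He. pose proof (Qpa_eq k Hk) as HQ.
  pose proof sqrt_level_pos as Hs. pose proof (Rpower_pos k (1 - p)) as Hm.
  pose proof (hslope_pos p Hp _ Hy) as HK.
  pose proof (is_derive_height_sq k Hk) as D1.
  pose proof (hroot_derive p Hp _ Hy) as D2.
  set (x := hroot p (height p a k ^ 2)) in *.
  assert (Hxe : -1 < x / E < 1).
  { split; apply (Rmult_lt_reg_r E); try lra; replace (x / E * E) with x by (field; lra); lra. }
  pose proof (is_derive_asin _ Hxe) as D3.
  pose proof (RInt_derive_cont (psi p E) 0 (psi_continuous p Hp E) (asin (x / E))) as D4.
  set (v := E * cos (asin (x / E))).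
  assert (Hv2 : v ^ 2 = E ^ 2 - x ^ 2).
  { unfold v. pose proof (sin2_cos2 (asin (x / E))) as S. rewrite sin_asin in S by lra.
    unfold Rsqr in S. replace ((E * cos (asin (x / E))) ^ 2) with (E ^ 2 * (cos (asin (x / E)) * cos (asin (x / E)))) by ring.
    replace (cos (asin (x / E)) * cos (asin (x / E))) with (1 - x / E * (x / E)) by lra. field. lra. }
  assert (Hvs : v = E * sqrt (1 - (x / E) ^ 2)).
  { unfold v. rewrite cos_asin by lra. now rewrite Rsqr_pow2. }
  assert (Hcos : 0 < sqrt (1 - (x / E) ^ 2)).
  { apply sqrt_lt_R0. replace (1 - (x / E) ^ 2) with ((1 - x / E) * (1 + x / E)) by ring. apply Rmult_lt_0_compat; lra. }
  assert (Hv : 0 < v) by (rewrite Hvs; now apply Rmult_lt_0_compat).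
  assert (Hpsi : psi p E (asin (x / E)) = (1 - p) * height p a k * hslope p (height p a k ^ 2) / eslope v).
  { unfold psi. fold v. f_equal. rewrite sin_asin by lra.
    replace (E * (x / E)) with x by (field; lra). unfold amp, x. rewrite hinv_hroot by easy.
    rewrite sqrt_pow2 by lra. easy. }
  assert (Her : 0 < eroot v) by (rewrite eroot_eq; apply Rmult_lt_0_compat; [easy|apply eslope_pos]).
  assert (Her2 : eroot v ^ 2 = (1 - height p a k ^ 2 - momentum p a k ^ 2) / momentum p a k ^ 2).
  { rewrite eroot_sq, Hv2, <- He by apply Hy.
    pose proof Hy as [_ Hy1].
    unfold x. rewrite hroot_sq by easy.
    replace (pot p (height p a k ^ 2) + ln ((1 - height p a k ^ 2) / momentum p a k ^ 2) - pot p (height p a k ^ 2))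
      with (ln ((1 - height p a k ^ 2) / momentum p a k ^ 2)) by ring.
    rewrite exp_ln; [field; lra|]. apply Rdiv_lt_0_compat; [lra|]. apply pow_lt; lra. }
  (* The singular factor [sqrt (Qpa p a k)] is thus a multiple of [eroot v = v * eslope v]; the
     derivative of [asin] contributes [E / v], which accounts for the singularity. *)
  assert (HQ2 : Qpa p a k = ((1 - p) * k * eroot v) ^ 2).
  { rewrite HQ. replace (((1 - p) * k * eroot v) ^ 2) with (((1 - p) * k) ^ 2 * eroot v ^ 2) by ring.
    rewrite Her2. unfold momentum. pose proof sqrt_level_sq as Hsq; set (r := sqrt a) in *; rewrite <- Hsq. field. lra. }
  assert (Hden : a * Rpower k (2 * (1 - p)) - p ^ 2 = a * Rpower k (1 - p) ^ 2 * (1 - height p a k ^ 2)).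
  { replace (2 * (1 - p)) with ((1 - p) + (1 - p)) by ring. rewrite Rpower_plus. unfold height.
    pose proof sqrt_level_sq as Hsq; set (r := sqrt a) in *; rewrite <- Hsq. field. lra. }
  pose proof Hy as Hy'. unfold unit_itv in Hy'.
  assert (Hpk : 0 < (1 - p) * k * eroot v) by (apply Rmult_lt_0_compat; [nra|easy]).
  split; [|split].
  - unfold Lambda_integrand. rewrite Hden, HQ2, sqrt_pow2 by lra.
    assert (D5 : is_derive (fun k => hroot p (height p a k ^ 2) / E) k
        (- (2 * (1 - p) * height p a k ^ 2 / k) * / (2 * (1 - p) * height p a k ^ 2 * (1 - height p a k ^ 2) * hslope p (height p a k ^ 2)) / E)).
    { apply (is_derive_ext (fun k => / E * hroot p (height p a k ^ 2))).
      { intros t. apply Rminus_diag_uniq. unfold Rdiv. ring. }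
      eapply is_derive_to_eq.
      - apply is_derive_scal. apply (is_derive_comp (hroot p) (fun k => height p a k ^ 2)); [apply D2|apply D1].
      - unfold scal; simpl; unfold mult; simpl. unfold Rdiv. ring. }
    pose proof (is_derive_comp asin (fun k => hroot p (height p a k ^ 2) / E) k _ _ D3 D5) as D6.
    pose proof (is_derive_comp (fun x => RInt (psi p E) 0 x) (fun k => asin (hroot p (height p a k ^ 2) / E)) k _ _ D4 D6) as D7.
    eapply is_derive_to_eq.
    + apply (is_derive_scal (fun k => RInt (psi p E) 0 (asin (hroot p (height p a k ^ 2) / E)))). apply D7.
    + rewrite Hpsi. unfold scal; cbn -[pow]; unfold mult; cbn -[pow].
      replace (/ sqrt (1 - (x / E) ^ 2)) with (E / v) by (rewrite Hvs; field; lra).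
      replace (eroot v) with (v * eslope v) by (rewrite eroot_eq; easy).
      pose proof (eslope_pos v).
      replace (2 * p * (1 - p) ^ 2 * sqrt a * Rpower k (1 - p)) with (2 * (1 - p) ^ 2 * (height p a k * a * Rpower k (1 - p) ^ 2)).
      * pose proof level_pos as Ha. fold a in Ha.
        field. split_and; lra.
      * unfold height. pose proof sqrt_level_sq as Hsq; set (r := sqrt a) in *; rewrite <- Hsq. field. lra.
  - rewrite HQ2. now apply pow_lt.
  - rewrite Hden. apply Rmult_lt_0_compat; [|lra].
    apply Rmult_lt_0_compat; [apply level_pos|apply pow_lt, Rpower_pos].
Qed.

End Level.

(** * The improper integral over the curvature equals the integral over one turn *)

Section Period.
Context (p : R) (Hp : 0 < p < 1) (E : R) (HE : 0 < E).

Let a := level p E.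
Let phase (k : R) : R := hroot p (height p a k ^ 2) / E.

Lemma phase_continuous (k : R) : 0 < k -> unit_itv (height p a k ^ 2) -> continuous phase k.
Proof.
  intros Hk Hy. unfold phase.
  apply (continuous_mult (fun k => hroot p (height p a k ^ 2)) (fun _ => / E)); [|apply continuous_const].
  apply (continuous_comp (fun k => height p a k ^ 2) (hroot p)).
  - eapply is_derive_continuous. now apply is_derive_height_sq.
  - now apply hroot_continuous.
Qed.

Lemma locally_unit_height (k : R) : 0 < k -> unit_itv (height p a k ^ 2) ->
  locally k (fun t => 0 < t /\ unit_itv (height p a t ^ 2)).
Proof.
  intros Hk Hy. apply filter_and; [exact (open_gt 0 k Hk)|].
  pose proof (is_derive_continuous _ _ _ (is_derive_height_sq p E k Hk)) as Hc.
  exact (Hc _ (unit_itv_open _ Hy)).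
Qed.

(** Continuity alone gives a two-sided limit; strict monotonicity of the height places the values
    below 1, where the limit of [asin] is taken. *)
Lemma filterlim_phase_left (k : R) : 0 < k -> height p a k ^ 2 = hinv p E ->
  filterlim phase (at_right k) (at_left 1).
Proof.
  intros Hk Hy P HP.
  assert (Hu : unit_itv (height p a k ^ 2)) by (rewrite Hy; now apply hinv_unit).
  assert (Hph : phase k = 1) by (unfold phase; rewrite Hy, hroot_hinv by easy; field; lra).
  change (locally 1 (fun u => u < 1 -> P u)) in HP.
  pose proof (phase_continuous k Hk Hu) as Hc. rewrite <- Hph in HP.
  pose proof (Hc _ HP) as HP1.
  change (locally k (fun t => phase t < phase k -> P (phase t))) in HP1.
  change (locally k (fun t => k < t -> P (phase t))).
  pose proof (filter_and _ _ HP1 (locally_unit_height k Hk Hu)) as HP2. revert HP2.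
  apply filter_imp. intros t [H1 [H2 H3]] Ht. apply H1.
  unfold phase. apply Rmult_lt_compat_r; [now apply Rinv_0_lt_compat|].
  apply hroot_incr; auto. now apply height_decr.
Qed.

Lemma filterlim_phase_right (k : R) : 0 < k -> height p a k ^ 2 = hinv p (- E) ->
  filterlim phase (at_left k) (at_right (-1)).
Proof.
  intros Hk Hy P HP.
  assert (Hu : unit_itv (height p a k ^ 2)) by (rewrite Hy; now apply hinv_unit).
  assert (Hph : phase k = -1) by (unfold phase; rewrite Hy, hroot_hinv by easy; field; lra).
  change (locally (-1) (fun u => -1 < u -> P u)) in HP.
  pose proof (phase_continuous k Hk Hu) as Hc. rewrite <- Hph in HP.
  pose proof (Hc _ HP) as HP1.
  change (locally k (fun t => phase k < phase t -> P (phase t))) in HP1.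
  change (locally k (fun t => t < k -> P (phase t))).
  pose proof (filter_and _ _ HP1 (locally_unit_height k Hk Hu)) as HP2. revert HP2.
  apply filter_imp. intros t [H1 [H2 H3]] Ht. apply H1.
  unfold phase. apply Rmult_lt_compat_r; [now apply Rinv_0_lt_compat|].
  apply hroot_incr; auto. now apply height_decr.
Qed.

Lemma Lambda_is_Lam : Lambda_is p a (Lam p E).
Proof.
  pose proof (hinv_unit p Hp E) as U1. pose proof (hinv_unit p Hp (- E)) as U2.
  (* The smaller root [beta] belongs to the larger height, hence to [+ E]. *)
  destruct (height_surj p Hp E (hinv p E) (proj1 U1)) as [beta [Hb0 Hb]].
  destruct (height_surj p Hp E (hinv p (- E)) (proj1 U2)) as [alpha [Ha0 Ha]].
  fold a in Ha, Hb.
  assert (Hlt : hinv p (- E) < hinv p E).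
  { apply hinv_lt; [easy..|]. rewrite hroot_hinv by easy. lra. }
  assert (Hba : beta < alpha).
  { destruct (Rtotal_order beta alpha) as [H|[H|H]]; [easy| |].
    - subst. lra.
    - apply (height_decr p Hp E) in H; [|easy]. fold a in H. lra. }
  exists beta, alpha. split; [easy|]. split; [easy|].
  split; [apply (Qpa_zero_hroot p Hp E); auto|]. split; [apply (Qpa_zero_hroot p Hp E); auto|].
  split.
  { intros k Hk HQ. apply (Qpa_zero_hroot p Hp E) in HQ; [|easy]. fold a in HQ.
    destruct HQ as [HQ|HQ]; [left|right]; apply (height_inj p Hp E); auto; fold a; congruence. }
  set (A := fun k => -2 * RInt (psi p E) 0 (asin (phase k))).
  assert (HA : forall k, beta < k < alpha ->
    is_derive A k (Lambda_integrand p a k) /\ 0 < Qpa p a k /\ 0 < a * Rpower k (2 * (1 - p)) - p ^ 2).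
  { intros k Hk. pose proof (height_decr p Hp E beta k Hb0 (proj1 Hk)) as H1.
    pose proof (height_decr p Hp E k alpha ltac:(lra) (proj2 Hk)) as H2.
    fold a in H1, H2. rewrite Hb in H1. rewrite Ha in H2.
    assert (U : unit_itv (height p a k ^ 2)) by (unfold unit_itv in *; lra).
    apply is_derive_phase; auto; [lra|]. fold a.
    rewrite <- (hroot_hinv p Hp E) at 2. rewrite <- (hroot_hinv p Hp (- E)) at 1.
    split; apply hroot_incr; auto. }
  assert (Hprod : filter_prod (at_right beta) (at_left alpha) (fun ab => forall x,
     Rmin (fst ab) (snd ab) <= x <= Rmax (fst ab) (snd ab) -> beta < x < alpha)).
  { apply (Filter_prod _ _ _ (fun u => beta < u < alpha) (fun u => beta < u < alpha)).
    - change (locally beta (fun u => beta < u -> beta < u < alpha)).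
      generalize (open_lt alpha beta Hba). apply filter_imp. intros; split; easy.
    - change (locally alpha (fun u => u < alpha -> beta < u < alpha)).
      generalize (open_gt beta alpha Hba). apply filter_imp. intros; split; easy.
    - intros x y Hx Hy t Ht. simpl in Ht.
      pose proof (Rmin_glb_lt x y beta ltac:(lra) ltac:(lra)). pose proof (Rmax_lub_lt x y alpha ltac:(lra) ltac:(lra)). lra. }
  apply (is_RInt_gen_ext (Derive A)).
  { revert Hprod. apply filter_imp. intros ab H x Hx. apply is_derive_unique, HA, H. lra. }
  (* The phase runs from [PI / 2] at [beta] down to [- (PI / 2)] at [alpha]; this is the difference
     of the limits of the primitive [A]. *)
  replace (Lam p E) with (-2 * RInt (psi p E) 0 (- (PI / 2)) - -2 * RInt (psi p E) 0 (PI / 2)).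
  2:{ rewrite Lam_half by easy.
      pose proof (ex_RInt_cont _ 0 (- (PI / 2)) (psi_continuous p Hp E)) as I1.
      pose proof (ex_RInt_cont _ (- (PI / 2)) (PI / 2) (psi_continuous p Hp E)) as I2.
      rewrite <- (RInt_Chasles _ _ _ _ I1 I2). unfold plus; simpl. ring. }
  assert (Hlim : forall t, filterlim (fun t => -2 * RInt (psi p E) 0 t) (locally t) (locally (-2 * RInt (psi p E) 0 t))).
  { intros t. apply (continuous_mult (fun _ => -2) (fun t => RInt (psi p E) 0 t)); [apply continuous_const|].
    eapply is_derive_continuous. apply RInt_derive_cont. now apply psi_continuous. }
  apply is_RInt_gen_Derive.
  - revert Hprod. apply filter_imp. intros ab H x Hx. eexists. apply HA, H, Hx.
  - revert Hprod. apply filter_imp. intros ab H x Hx. specialize (H x Hx).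
    apply (continuous_ext_loc _ (Lambda_integrand p a)).
    + assert (L : locally x (fun t => beta < t < alpha)).
      { apply filter_and; [exact (open_gt beta x (proj1 H))|exact (open_lt alpha x (proj2 H))]. }
      revert L. apply filter_imp. intros t Ht. symmetry. apply is_derive_unique, HA, Ht.
    + destruct (HA x H) as [_ [H1 H2]]. apply (ex_derive_continuous (Lambda_integrand p a)).
      unfold Lambda_integrand, Qpa in *.
      assert (ex_derive (fun k => Rpower k (1 - p)) x) by (eexists; apply is_derive_Rpower; lra).
      assert (ex_derive (fun k => Rpower k (2 * (1 - p))) x) by (eexists; apply is_derive_Rpower; lra).
      pose proof (sqrt_lt_R0 _ H1).
      auto_derive. split_and; auto; try exact I.
      apply Rgt_not_eq, Rmult_lt_0_compat; [simpl in H2; lra|exact H4].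
  - apply (filterlim_comp _ _ _ (fun k => asin (phase k)) (fun t => -2 * RInt (psi p E) 0 t) _ (locally (PI / 2)));
      [|apply Hlim].
    apply (filterlim_comp _ _ _ phase asin _ (at_left 1)); [|apply filterlim_asin_left].
    now apply filterlim_phase_left.
  - apply (filterlim_comp _ _ _ (fun k => asin (phase k)) (fun t => -2 * RInt (psi p E) 0 t) _ (locally (- (PI / 2))));
      [|apply Hlim].
    apply (filterlim_comp _ _ _ phase asin _ (at_right (-1))); [|apply filterlim_asin_right].
    now apply filterlim_phase_right.
Qed.

End Period.

(** * Phase of a solution *)

Lemma sin_cos_param (a b : R) : a ^ 2 + b ^ 2 = 1 -> exists t, sin t = a /\ cos t = b.
Proof.
  intros H. assert (Ha : -1 <= a <= 1) by nra.
  pose proof (sin_asin a Ha) as S. pose proof (cos_asin a Ha) as C.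
  assert (Hb : 1 - a² = b²) by (rewrite !Rsqr_pow2; lra).
  rewrite Hb, sqrt_Rsqr_abs in C.
  destruct (Rle_lt_dec 0 b).
  - exists (asin a). rewrite C, Rabs_pos_eq; easy.
  - exists (PI - asin a). split; [now rewrite sin_PI_x|].
    rewrite cos_minus, cos_PI, sin_PI, C, Rabs_left by easy. ring.
Qed.

Lemma cos_eq_1_multiple (x : R) : cos x = 1 -> exists j : Z, x = 2 * PI * IZR j.
Proof.
  intros H. replace x with (2 * (x / 2)) in H by field. rewrite cos_2a_sin in H.
  assert (S : sin (x / 2) = 0) by nra.
  apply sin_eq_0_0 in S. destruct S as [j Hj]. exists j.
  replace x with (2 * (x / 2)) by field. rewrite Hj. ring.
Qed.

Section Profile.
Context (p : R) (Hp : 0 < p < 1) (E : R) (HE : 0 < E).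
Context (k z z1 nu : R -> R) (rho : R).
Context (Hz : forall s, 0 < z s) (Hnu : forall s, 0 < nu s).
Context (Dz : forall s, is_derive z s (z1 s)).
Context (Dz1 : forall s, is_derive z1 s (k s * nu s - z s)).
Context (Dnu : forall s, is_derive nu s (- k s * z1 s)).
Context (Hunit : forall s, z s ^ 2 + z1 s ^ 2 + nu s ^ 2 = 1).
Context (Hknu : forall s, (1 - p) * (k s * z s) = p * nu s).
Context (Henergy : forall s, pot p (z s ^ 2) + ln ((1 - z s ^ 2) / nu s ^ 2) = E ^ 2).
Context (Hrho : 0 < rho) (Pz : forall s, z (s + rho) = z s)
  (Pz1 : forall s, z1 (s + rho) = z1 s) (Pnu : forall s, nu (s + rho) = nu s).
Context (Hmin : forall t, 0 < t < rho -> ~ (forall s, z (s + t) = z s)).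

Let y (s : R) : R := z s ^ 2.
Let w (s : R) : R := z1 s / nu s.
Let x (s : R) : R := hroot p (y s).
Let v (s : R) : R := lroot (w s).
(** The speed of the phase: the quotient of [x'] by [v], once [z1] is written as
    [nu * v * eslope v]. *)
Let om (s : R) : R := nu s * eslope (v s) / ((1 - p) * z s * (1 - y s) * hslope p (y s)).

Lemma profile_unit (s : R) : unit_itv (y s).
Proof.
  unfold unit_itv, y. pose proof (Hunit s). pose proof (pow_lt _ 2 (Hz s)). pose proof (pow_lt _ 2 (Hnu s)).
  pose proof (pow2_ge_0 (z1 s)). lra.
Qed.

Lemma profile_w (s : R) : 1 + w s ^ 2 = (1 - y s) / nu s ^ 2.
Proof.
  unfold w, y. pose proof (Hnu s). replace (1 - z s ^ 2) with (z1 s ^ 2 + nu s ^ 2) by (pose proof (Hunit s); lra).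
  field. lra.
Qed.

Lemma om_pos (s : R) : 0 < om s.
Proof.
  pose proof (profile_unit s) as U. pose proof (hslope_pos p Hp _ U). unfold unit_itv in U.
  apply Rdiv_lt_0_compat.
  - apply Rmult_lt_0_compat; [apply Hnu|apply eslope_pos].
  - apply Rmult_lt_0_compat; [|easy]. apply Rmult_lt_0_compat; [|lra].
    apply Rmult_lt_0_compat; [lra|apply Hz].
Qed.

Lemma profile_Dy (s : R) : is_derive y s (2 * z s * z1 s).
Proof.
  unfold y. pose proof (Dz s) as H. auto_derive; [ex_der|]. derive_with H. ring.
Qed.

(** [Hknu] eliminates the curvature and [nu^2 + z1^2 = 1 - y]; the numerator becomes
    [p (1 - y) - (1 - p) y = p - y], which vanishes at the centre of [pot]. *)
Lemma profile_Dw (s : R) : is_derive w s ((p - y s) / ((1 - p) * z s * nu s)).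
Proof.
  unfold w. pose proof (Dz1 s) as H1. pose proof (Dnu s) as H2. pose proof (Hnu s). pose proof (Hz s).
  auto_derive.
  - ex_der. lra.
  - derive_with H1. derive_with H2.
    assert (Hk : k s = p * nu s / ((1 - p) * z s)) by (rewrite <- Hknu; field; lra).
    rewrite Hk. unfold y.
    pose proof (Hunit s) as Hu.
    apply (Rmult_eq_reg_l ((1 - p) * z s * nu s ^ 2)).
    + transitivity (p * (nu s ^ 2 + z1 s ^ 2) * nu s - (1 - p) * z s ^ 2 * nu s).
      * field. lra.
      * replace (nu s ^ 2 + z1 s ^ 2) with (1 - z s ^ 2) by lra. field. lra.
    + apply Rgt_not_eq. apply Rmult_lt_0_compat; [nra|now apply pow_lt].
Qed.

Lemma profile_Dx (s : R) : is_derive x s (om s * v s).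
Proof.
  pose proof (profile_unit s) as U. pose proof (hslope_pos p Hp _ U) as HK.
  pose proof (is_derive_comp (hroot p) y s _ _ (hroot_derive p Hp _ U) (profile_Dy s)) as H.
  eapply is_derive_to_eq; [apply H|].
  unfold scal; cbn -[pow]; unfold mult; cbn -[pow].
  pose proof (Hnu s). pose proof (Hz s). unfold unit_itv in U.
  assert (Hw : z1 s = nu s * (v s * eslope (v s))).
  { rewrite <- eroot_eq. unfold v. rewrite eroot_lroot. unfold w. field. lra. }
  rewrite Hw. unfold om.
  replace (2 * (1 - p) * y s * (1 - y s) * hslope p (y s)) with (2 * z s * ((1 - p) * z s * (1 - y s) * hslope p (y s))) by (unfold y; ring).
  field. split_and; lra.
Qed.

(** The same [om] appears because [y - p] is [x / hslope] and, by [lslope_eslope], the derivative of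
    [lroot] brings in [eslope v]. *)
Lemma profile_Dv (s : R) : is_derive v s (- om s * x s).
Proof.
  pose proof (profile_unit s) as U. pose proof (hslope_pos p Hp _ U) as HK.
  pose proof (is_derive_comp lroot w s _ _ (lroot_derive (w s)) (profile_Dw s)) as H.
  eapply is_derive_to_eq; [apply H|].
  unfold scal; cbn -[pow]; unfold mult; cbn -[pow].
  pose proof (Hnu s). pose proof (Hz s). unfold unit_itv in U.
  rewrite profile_w. pose proof (lslope_eslope (w s)) as He. fold (v s) in He.
  pose proof (lslope_pos (w s)).
  assert (He' : eslope (v s) = / lslope (w s)).
  { apply (Rmult_eq_reg_l (lslope (w s))); [|lra]. rewrite He. field. lra. }
  unfold om, x. rewrite He', hroot_eq. field. split_and; lra.
Qed.

Lemma profile_radius (s : R) : x s ^ 2 + v s ^ 2 = E ^ 2.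
Proof.
  unfold x, v. rewrite hroot_sq by (try easy; apply profile_unit). rewrite lroot_sq, profile_w. apply Henergy.
Qed.

Lemma om_continuous (s : R) : continuous om s.
Proof.
  pose proof (profile_unit s) as U. pose proof (hslope_pos p Hp _ U) as HK.
  unfold om.
  apply (continuous_mult (fun s => nu s * eslope (v s)) (fun s => / ((1 - p) * z s * (1 - y s) * hslope p (y s)))).
  - apply (continuous_mult nu (fun s => eslope (v s))); [eapply is_derive_continuous, Dnu|].
    apply (continuous_comp v eslope); [eapply is_derive_continuous, profile_Dv|apply eslope_continuous].
  - apply (continuous_comp (fun s => (1 - p) * z s * (1 - y s) * hslope p (y s)) Rinv).
    + apply (continuous_mult (fun s => (1 - p) * z s * (1 - y s)) (fun s => hslope p (y s))).
      * apply (continuous_mult (fun s => (1 - p) * z s) (fun s => 1 - y s)).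
        -- apply (continuous_mult (fun _ => 1 - p) z); [apply continuous_const|eapply is_derive_continuous, Dz].
        -- apply (continuous_minus (fun _ => 1) y); [apply continuous_const|eapply is_derive_continuous, profile_Dy].
      * apply (continuous_comp y (hslope p)); [eapply is_derive_continuous, profile_Dy|].
        apply (slope_continuous _ _ _ _ (pot_quad_min p Hp)), U.
    + apply continuous_Rinv. unfold unit_itv in U. pose proof (Hz s).
      apply Rgt_not_eq. apply Rmult_lt_0_compat; [|easy]. apply Rmult_lt_0_compat; [nra|lra].
Qed.

Lemma profile_phase : exists Th : R -> R,
  (forall s, is_derive Th s (om s)) /\
  (forall s, x s = E * sin (Th s)) /\ (forall s, v s = E * cos (Th s)).
Proof.
  destruct (sin_cos_param (x 0 / E) (v 0 / E)) as [t0 [S C]].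
  { pose proof (profile_radius 0) as H.
    replace ((x 0 / E) ^ 2 + (v 0 / E) ^ 2) with ((x 0 ^ 2 + v 0 ^ 2) / E ^ 2) by (field; lra).
    rewrite H. field. lra. }
  set (Th := fun s => t0 + RInt om 0 s).
  assert (DT : forall s, is_derive Th s (om s)).
  { intros s. unfold Th. apply is_derive_to_eq with (0 + om s); [|ring].
    apply (is_derive_plus (fun _ => t0) (fun s => RInt om 0 s)); [apply (@is_derive_const R_AbsRing R_NormedModule)|].
    apply RInt_derive_cont, om_continuous. }
  assert (T0 : Th 0 = t0) by (unfold Th; rewrite RInt_point; unfold zero; simpl; ring).
  exists Th. split; [easy|].
  pose proof (rotation_ode x v om Th profile_Dx profile_Dv DT) as HR.
  assert (X0 : x 0 = E * sin (Th 0)) by (rewrite T0, S; field; lra).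
  assert (V0 : v 0 = E * cos (Th 0)) by (rewrite T0, C; field; lra).
  split; intros s; destruct (HR s) as [H1 H2].
  - rewrite H1, X0, V0. replace (Th s) with (Th 0 + (Th s - Th 0)) at 3 by ring.
    rewrite sin_plus. ring.
  - rewrite H2, X0, V0. replace (Th s) with (Th 0 + (Th s - Th 0)) at 3 by ring.
    rewrite cos_plus. ring.
Qed.

Lemma profile_y (s t : R) : x s = E * sin t -> hinv p (E * sin t) = y s.
Proof. intros <-. apply hinv_hroot; [easy|apply profile_unit]. Qed.

Lemma profile_psi (s t : R) : x s = E * sin t -> v s = E * cos t ->
  psi p E t * om s = nu s / (1 - z s ^ 2).
Proof.
  intros Hx Hv. unfold psi, amp. rewrite (profile_y s t Hx), <- Hv.
  unfold y at 1. rewrite sqrt_pow2 by (apply Rlt_le, Hz).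
  pose proof (profile_unit s) as U. pose proof (hslope_pos p Hp _ U) as HK.
  pose proof (eslope_pos (v s)). pose proof (Hz s). unfold unit_itv in U.
  unfold om. fold (y s). field. split_and; lra.
Qed.

(* The system is autonomous: the reciprocal speed of the phase depends on the phase alone. *)
Let slow (t : R) : R := psi p E t * sqrt ((1 - hinv p (E * sin t)) * exp ((E * cos t) ^ 2)).

(** Along the profile [exp (v^2) = (1 - y) / nu^2], so the square root in [slow] is [(1 - y) / nu],
    the reciprocal of the angular speed that [psi * om] equals. *)
Lemma slow_om (s t : R) : x s = E * sin t -> v s = E * cos t -> slow t * om s = 1.
Proof.
  intros Hx Hv. unfold slow.
  replace (psi p E t * sqrt ((1 - hinv p (E * sin t)) * exp ((E * cos t) ^ 2)) * om s)
    with (psi p E t * om s * sqrt ((1 - hinv p (E * sin t)) * exp ((E * cos t) ^ 2))) by ring.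
  rewrite (profile_psi s t Hx Hv), (profile_y s t Hx), <- Hv.
  unfold v. rewrite lroot_sq, profile_w.
  pose proof (profile_unit s) as U. unfold unit_itv in U. pose proof (Hnu s).
  rewrite exp_ln by (apply Rdiv_lt_0_compat; [lra|now apply pow_lt]).
  replace ((1 - y s) * ((1 - y s) / nu s ^ 2)) with (((1 - y s) / nu s) ^ 2) by (field; lra).
  rewrite sqrt_pow2 by (apply Rlt_le, Rdiv_lt_0_compat; lra).
  fold (y s). field. lra.
Qed.

Lemma slow_continuous (t : R) : continuous slow t.
Proof.
  unfold slow.
  apply (continuous_mult (psi p E) (fun t => sqrt ((1 - hinv p (E * sin t)) * exp ((E * cos t) ^ 2)))).
  - now apply psi_continuous.
  - apply (continuous_comp (fun t => (1 - hinv p (E * sin t)) * exp ((E * cos t) ^ 2)) sqrt); [|apply continuous_sqrt].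
    apply (continuous_mult (fun t => 1 - hinv p (E * sin t)) (fun t => exp ((E * cos t) ^ 2))).
    + apply (continuous_minus (fun _ => 1) (fun t => hinv p (E * sin t))); [apply continuous_const|].
      apply (continuous_comp (fun t => E * sin t) (hinv p)); [|now apply hinv_continuous].
      apply (continuous_mult (fun _ => E) sin); [apply continuous_const|apply continuous_sin].
    + apply (ex_derive_continuous (fun t => exp ((E * cos t) ^ 2))). auto_derive. easy.
Qed.

Lemma slow_pos (t : R) : 0 < slow t.
Proof.
  pose proof (hinv_unit p Hp (E * sin t)) as U. pose proof (hslope_pos p Hp _ U).
  unfold slow, psi, amp. unfold unit_itv in U.
  apply Rmult_lt_0_compat.
  - apply Rdiv_lt_0_compat; [|apply eslope_pos]. apply Rmult_lt_0_compat; [|easy].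
    apply Rmult_lt_0_compat; [lra|]. apply sqrt_lt_R0. lra.
  - apply sqrt_lt_R0. apply Rmult_lt_0_compat; [lra|apply exp_pos].
Qed.

Lemma slow_period (t : R) : slow (t + 2 * PI) = slow t.
Proof.
  unfold slow. rewrite psi_period, sin_plus, cos_plus, sin_2PI, cos_2PI.
  now rewrite !Rmult_0_r, !Rmult_1_r, Rplus_0_r, Rminus_0_r.
Qed.

(** [Tm], the primitive of [slow], is elapsed time as a function of the phase: [Tm (Th s) - s] is
    constant. It gains a fixed amount per turn and is injective, so a turn takes the same time from
    every starting point. *)
Lemma phase_shift (Th : R -> R) :
  (forall s, is_derive Th s (om s)) ->
  (forall s, x s = E * sin (Th s)) -> (forall s, v s = E * cos (Th s)) ->
  forall t, Th t = Th 0 + 2 * PI -> forall s, Th (s + t) = Th s + 2 * PI.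
Proof.
  intros DT Hx Hv.
  set (Tm := fun t => RInt slow 0 t).
  assert (DTm : forall t, is_derive Tm t (slow t)) by (apply RInt_derive_cont, slow_continuous).
  assert (Hinc : forall a b, a < b -> Tm a < Tm b).
  { intros a b Hab. apply (is_derive_pos_lt everywhere Tm slow); try easy. intros; apply slow_pos. }
  assert (Htime : forall s, Tm (Th s) = Tm (Th 0) + s).
  { intros s. enough (Tm (Th s) - s = Tm (Th 0) - 0) by lra.
    apply (is_derive_zero_const (fun s => Tm (Th s) - s)). intros u.
    apply is_derive_to_eq with (om u * slow (Th u) - 1); [|rewrite Rmult_comm, slow_om by auto; ring].
    apply (is_derive_minus (fun s => Tm (Th s)) (fun s => s)); [|apply (is_derive_id u)].
    apply (is_derive_comp Tm Th); [apply DTm|apply DT]. }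
  assert (Hper : forall t, Tm (t + 2 * PI) = Tm t + Tm (2 * PI)).
  { intros t. unfold Tm.
    rewrite <- (RInt_Chasles slow 0 t (t + 2 * PI)) by apply ex_RInt_cont, slow_continuous.
    unfold plus; simpl. f_equal. apply RInt_periodic; [apply slow_continuous|apply slow_period]. }
  intros t Ht s.
  assert (Eq : Tm (Th (s + t)) = Tm (Th s + 2 * PI)).
  { rewrite Hper, (Htime (s + t)), (Htime s). pose proof (Htime t) as H. rewrite Ht, Hper in H. lra. }
  destruct (Rtotal_order (Th (s + t)) (Th s + 2 * PI)) as [H|[H|H]]; [|easy|]; apply Hinc in H; lra.
Qed.

(** Periodicity gives a whole number [j >= 1] of turns over [rho]. If [j >= 2], the first turn is
    completed at some time inside [(0, rho)], which by [phase_shift] is a period of the height and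
    contradicts minimality. *)
Lemma phase_period (Th : R -> R) :
  (forall s, is_derive Th s (om s)) ->
  (forall s, x s = E * sin (Th s)) -> (forall s, v s = E * cos (Th s)) ->
  forall s, Th (s + rho) = Th s + 2 * PI.
Proof.
  intros DT Hx Hv. pose proof PI_RGT_0 as HPI.
  apply phase_shift; auto.
  assert (Hinc : Th 0 < Th rho).
  { apply (is_derive_pos_lt everywhere Th om); try easy. intros; apply om_pos. }
  assert (Px : x rho = x 0) by (unfold x, y; now rewrite <- (Pz 0), Rplus_0_l).
  assert (Pv : v rho = v 0) by (unfold v, w; now rewrite <- (Pz1 0), <- (Pnu 0), Rplus_0_l).
  rewrite !Hx in Px. rewrite !Hv in Pv.
  apply Rmult_eq_reg_l in Px; [|lra]. apply Rmult_eq_reg_l in Pv; [|lra].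
  destruct (cos_eq_1_multiple (Th rho - Th 0)) as [j Hj].
  { rewrite cos_minus, Px, Pv. pose proof (sin2_cos2 (Th 0)) as H. unfold Rsqr in H. lra. }
  assert (Hj0 : 0 < IZR j) by nra.
  apply lt_IZR in Hj0.
  destruct (Z.eq_dec j 1) as [->|Hj1]; [lra|].
  assert (Hj2 : 2 <= IZR j) by (apply IZR_le; lia).
  exfalso.
  destruct (IVT_gen_consistent Th 0 rho (Th 0 + 2 * PI)) as [t [Ht1 Ht2]].
  { intros u. eapply is_derive_continuous, DT. }
  { rewrite Rmin_left, Rmax_right by lra. nra. }
  rewrite Rmin_left, Rmax_right in Ht1 by lra.
  assert (t <> 0) by (intros ->; lra).
  assert (t <> rho) by (intros ->; nra).
  apply (Hmin t); [lra|]. intros s.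
  pose proof (phase_shift Th DT Hx Hv t Ht2 s) as Hs.
  assert (Ey : y (s + t) = y s).
  { rewrite <- (profile_y (s + t) _ (Hx (s + t))), <- (profile_y s _ (Hx s)).
    rewrite Hs, sin_plus, sin_2PI, cos_2PI. do 2 f_equal. ring. }
  unfold y in Ey. rewrite <- (sqrt_pow2 (z (s + t))), <- (sqrt_pow2 (z s)) by apply Rlt_le, Hz.
  now rewrite Ey.
Qed.

Lemma profile_angle : exists Ph : R -> R, Ph 0 = 0 /\
  (forall s, is_derive Ph s (nu s / (1 - z s ^ 2))) /\
  (forall s, Ph (s + rho) = Ph s + Lam p E).
Proof.
  destruct profile_phase as [Th [DT [Hx Hv]]].
  pose proof (psi_continuous p Hp E) as Hc.
  exists (fun s => RInt (psi p E) (Th 0) (Th s)). split; [|split].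
  - now rewrite RInt_point.
  - intros s. rewrite <- (profile_psi s (Th s)) by auto. rewrite Rmult_comm.
    apply (is_derive_comp (fun t => RInt (psi p E) (Th 0) t) Th); [|apply DT].
    now apply RInt_derive_cont.
  - intros s. rewrite (phase_period Th DT Hx Hv).
    rewrite <- (RInt_Chasles (psi p E) (Th 0) (Th s) (Th s + 2 * PI)) by now apply ex_RInt_cont.
    unfold plus; simpl. f_equal. now apply RInt_psi_period.
Qed.

End Profile.

(** * Moving frame *)

Section Coordinate.
Context (g T N k z z1 nu Ph : R -> R).
Context (Dg : forall s, is_derive g s (T s)).
Context (DT : forall s, is_derive T s (k s * N s - g s)).
Context (DN : forall s, is_derive N s (- k s * T s)).
Context (Dz : forall s, is_derive z s (z1 s)).
Context (Dz1 : forall s, is_derive z1 s (k s * nu s - z s)).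
Context (Dnu : forall s, is_derive nu s (- k s * z1 s)).
Context (Hunit : forall s, z s ^ 2 + z1 s ^ 2 + nu s ^ 2 = 1).
Context (Hnu : forall s, 0 < nu s).
Context (Ph0 : Ph 0 = 0) (DPh : forall s, is_derive Ph s (nu s / (1 - z s ^ 2))).

Definition axis (s : R) : R := z s * g s + z1 s * T s + nu s * N s.

(* The conserved vector of the elastic curve: it is fixed in space, with frame coordinates [z], [z1], [nu]. *)
Lemma axis_const (s : R) : axis s = axis 0.
Proof.
  apply is_derive_zero_const. intros u. unfold axis.
  pose proof (Dg u) as H1. pose proof (DT u) as H2. pose proof (DN u) as H3.
  pose proof (Dz u) as H4. pose proof (Dz1 u) as H5. pose proof (Dnu u) as H6.
  auto_derive; [ex_der|].
  derive_with H1. derive_with H2. derive_with H3. derive_with H4. derive_with H5. derive_with H6. ring.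
Qed.

(** [f] and [h] are coordinates of two orthogonal vectors normal to the axis, [g] minus its axial
    part and the cross product of the axis with [g], both scaled to unit length. They rotate into
    each other with angular speed [nu / (1 - z^2)]. Each space coordinate is treated alone, so the
    axis may have any direction. *)
Lemma coord_rotation (s : R) :
  g s = z s * axis 0 + sqrt (1 - z s ^ 2) *
    ((g 0 - z 0 * axis 0) / sqrt (1 - z 0 ^ 2) * cos (Ph s) +
     (nu 0 * T 0 - z1 0 * N 0) / sqrt (1 - z 0 ^ 2) * sin (Ph s)).
Proof.
  assert (Hr : forall s, 0 < 1 - z s ^ 2).
  { intros t. pose proof (Hunit t). pose proof (pow2_ge_0 (z1 t)). pose proof (pow_lt _ 2 (Hnu t)). lra. }
  set (r := fun s => sqrt (1 - z s ^ 2)).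
  assert (Hr0 : forall s, 0 < r s) by (intros t; apply sqrt_lt_R0, Hr).
  assert (Hr2 : forall s, r s ^ 2 = 1 - z s ^ 2) by (intros t; apply pow2_sqrt, Rlt_le, Hr).
  assert (Dr : forall s, is_derive r s (- (z s * z1 s) / r s)).
  { intros t. pose proof (Dz t) as H. pose proof (Hr t). pose proof (Hr0 t). unfold r in *.
    auto_derive; [ex_der; simpl in *; lra|].
    derive_with H. replace (z t * (z t * 1)) with (z t ^ 2) by ring.
    replace (1 + - z t ^ 2) with (1 - z t ^ 2) by ring. field. lra. }
  set (f := fun s => (g s - z s * axis 0) / r s).
  set (h := fun s => (nu s * T s - z1 s * N s) / r s).
  assert (Df : forall s, is_derive f s (nu s / (1 - z s ^ 2) * h s)).
  { intros t. unfold f, h.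
    pose proof (Dg t) as H1. pose proof (Dz t) as H2. pose proof (Dr t) as H3. pose proof (Hr0 t).
    auto_derive; [ex_der; lra|].
    derive_with H1. derive_with H2. derive_with H3.
    rewrite <- (axis_const t). rewrite <- Hr2. unfold axis.
    apply (Rmult_eq_reg_l (r t ^ 3)); [|apply Rgt_not_eq, pow_lt; easy].
    transitivity (r t ^ 2 * T t - z1 t * (r t ^ 2 + z t ^ 2) * (z t * g t + z1 t * T t + nu t * N t) + z t * z1 t * g t).
    - field. lra.
    - transitivity (nu t * (nu t * T t - z1 t * N t)); [|field; lra].
      rewrite Hr2. replace (1 - z t ^ 2) with (z1 t ^ 2 + nu t ^ 2) by (pose proof (Hunit t); lra).
      replace (z1 t ^ 2 + nu t ^ 2 + z t ^ 2) with 1 by (pose proof (Hunit t); lra).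
      ring. }
  assert (Dh : forall s, is_derive h s (- (nu s / (1 - z s ^ 2)) * f s)).
  { intros t. unfold f, h.
    pose proof (DT t) as H1. pose proof (Dz1 t) as H2. pose proof (Dr t) as H3. pose proof (Hr0 t).
    pose proof (DN t) as H4. pose proof (Dnu t) as H5.
    auto_derive; [ex_der; lra|].
    derive_with H1. derive_with H2. derive_with H3. derive_with H4. derive_with H5.
    rewrite <- (axis_const t). rewrite <- Hr2. unfold axis.
    apply (Rmult_eq_reg_l (r t ^ 3)); [|apply Rgt_not_eq, pow_lt; easy].
    transitivity (r t ^ 2 * (z t * N t - nu t * g t) + z t * z1 t * (nu t * T t - z1 t * N t)).
    - field. lra.
    - transitivity (- nu t * ((1 - z t ^ 2) * g t - z t * z1 t * T t - z t * nu t * N t)).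
      + rewrite Hr2.
        transitivity (z t * (1 - z t ^ 2 - z1 t ^ 2) * N t - nu t * (1 - z t ^ 2) * g t + z t * z1 t * nu t * T t); [ring|].
        replace (1 - z t ^ 2 - z1 t ^ 2) with (nu t ^ 2) by (pose proof (Hunit t); lra). ring.
      + field. lra. }
  destruct (rotation_ode f h (fun s => nu s / (1 - z s ^ 2)) Ph Df Dh DPh s) as [H _].
  rewrite Ph0, Rminus_0_r in H. fold (r s) (r 0).
  change ((g 0 - z 0 * axis 0) / r 0) with (f 0).
  change ((nu 0 * T 0 - z1 0 * N 0) / r 0) with (h 0).
  rewrite <- H. unfold f. pose proof (Hr0 s). field. lra.
Qed.

End Coordinate.

Lemma is_derive_const_zero (f : R -> R) (c : R) : (forall s, f s = c) -> forall s l, is_derive f s l -> l = 0.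
Proof.
  intros Hf s l H. rewrite <- (is_derive_unique _ _ _ H).
  rewrite (Derive_ext f (fun _ => c)) by easy. apply Derive_const.
Qed.

(** * Frenet equations of a unit-speed curve on the sphere *)

Section Frenet.
Context (gx gy gz Tx Ty Tz Ax Ay Az Bx By Bz : R -> R).
Context (Dgx : forall s, is_derive gx s (Tx s)) (Dgy : forall s, is_derive gy s (Ty s))
  (Dgz : forall s, is_derive gz s (Tz s)).
Context (DTx : forall s, is_derive Tx s (Ax s)) (DTy : forall s, is_derive Ty s (Ay s))
  (DTz : forall s, is_derive Tz s (Az s)).
Context (DAx : forall s, is_derive Ax s (Bx s)) (DAy : forall s, is_derive Ay s (By s))
  (DAz : forall s, is_derive Az s (Bz s)).
Context (Hg : forall s, gx s ^ 2 + gy s ^ 2 + gz s ^ 2 = 1).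
Context (HT : forall s, Tx s ^ 2 + Ty s ^ 2 + Tz s ^ 2 = 1).

Let kap (s : R) : R := det3 (gx s) (gy s) (gz s) (Tx s) (Ty s) (Tz s) (Ax s) (Ay s) (Az s).
Let Nx (s : R) : R := gy s * Tz s - gz s * Ty s.
Let Ny (s : R) : R := gz s * Tx s - gx s * Tz s.
Let Nz (s : R) : R := gx s * Ty s - gy s * Tx s.

Lemma frenet_gT (s : R) : gx s * Tx s + gy s * Ty s + gz s * Tz s = 0.
Proof.
  enough (2 * (gx s * Tx s + gy s * Ty s + gz s * Tz s) = 0) by lra.
  apply (is_derive_const_zero _ _ Hg s).
  pose proof (Dgx s) as H1. pose proof (Dgy s) as H2. pose proof (Dgz s) as H3.
  auto_derive; [ex_der|]. derive_with H1. derive_with H2. derive_with H3. ring.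
Qed.

Lemma frenet_TA (s : R) : Tx s * Ax s + Ty s * Ay s + Tz s * Az s = 0.
Proof.
  enough (2 * (Tx s * Ax s + Ty s * Ay s + Tz s * Az s) = 0) by lra.
  apply (is_derive_const_zero _ _ HT s).
  pose proof (DTx s) as H1. pose proof (DTy s) as H2. pose proof (DTz s) as H3.
  auto_derive; [ex_der|]. derive_with H1. derive_with H2. derive_with H3. ring.
Qed.

Lemma frenet_gA (s : R) : gx s * Ax s + gy s * Ay s + gz s * Az s = -1.
Proof.
  enough (gx s * Ax s + gy s * Ay s + gz s * Az s + (Tx s ^ 2 + Ty s ^ 2 + Tz s ^ 2) = 0) by (rewrite HT in *; lra).
  apply (is_derive_const_zero _ _ frenet_gT s).
  pose proof (Dgx s) as H1. pose proof (Dgy s) as H2. pose proof (Dgz s) as H3.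
  pose proof (DTx s) as H4. pose proof (DTy s) as H5. pose proof (DTz s) as H6.
  auto_derive; [ex_der|].
  derive_with H1. derive_with H2. derive_with H3. derive_with H4. derive_with H5. derive_with H6. ring.
Qed.

Lemma frenet_NN (s : R) : Nx s ^ 2 + Ny s ^ 2 + Nz s ^ 2 = 1.
Proof.
  transitivity ((gx s ^ 2 + gy s ^ 2 + gz s ^ 2) * (Tx s ^ 2 + Ty s ^ 2 + Tz s ^ 2)
    - (gx s * Tx s + gy s * Ty s + gz s * Tz s) ^ 2).
  - unfold Nx, Ny, Nz. ring.
  - rewrite Hg, HT, frenet_gT. ring.
Qed.

Lemma frenet_A (s : R) :
  Ax s = kap s * Nx s - gx s /\ Ay s = kap s * Ny s - gy s /\ Az s = kap s * Nz s - gz s.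
Proof.
  set (gg := gx s ^ 2 + gy s ^ 2 + gz s ^ 2). set (TT := Tx s ^ 2 + Ty s ^ 2 + Tz s ^ 2).
  set (gT := gx s * Tx s + gy s * Ty s + gz s * Tz s).
  set (gA := gx s * Ax s + gy s * Ay s + gz s * Az s).
  set (TA := Tx s * Ax s + Ty s * Ay s + Tz s * Az s).
  (* Cramer's rule in the basis [g], [T], [g x T], cleared of the Gram determinant: a polynomial
     identity before any orthonormality is used. *)
  assert (C : (gg * TT - gT ^ 2) * Ax s = (gA * TT - TA * gT) * gx s + (TA * gg - gA * gT) * Tx s + kap s * Nx s /\
    (gg * TT - gT ^ 2) * Ay s = (gA * TT - TA * gT) * gy s + (TA * gg - gA * gT) * Ty s + kap s * Ny s /\
    (gg * TT - gT ^ 2) * Az s = (gA * TT - TA * gT) * gz s + (TA * gg - gA * gT) * Tz s + kap s * Nz s).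
  { unfold gg, TT, gT, gA, TA, kap, Nx, Ny, Nz, det3. split_and; ring. }
  assert (E1 : gg = 1) by apply Hg. assert (E2 : TT = 1) by apply HT.
  assert (E3 : gT = 0) by apply frenet_gT. assert (E4 : gA = -1) by apply frenet_gA.
  assert (E5 : TA = 0) by apply frenet_TA.
  rewrite E1, E2, E3, E4, E5 in C. destruct C as [C1 [C2 C3]]. split_and; lra.
Qed.

Lemma frenet_DT (s : R) :
  is_derive Tx s (kap s * Nx s - gx s) /\ is_derive Ty s (kap s * Ny s - gy s) /\
  is_derive Tz s (kap s * Nz s - gz s).
Proof. destruct (frenet_A s) as [<- [<- <-]]. split_and; auto. Qed.

Lemma frenet_DN (s : R) :
  is_derive Nx s (- kap s * Tx s) /\ is_derive Ny s (- kap s * Ty s) /\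
  is_derive Nz s (- kap s * Tz s).
Proof.
  pose proof (Dgx s) as H1. pose proof (Dgy s) as H2. pose proof (Dgz s) as H3.
  destruct (frenet_DT s) as [H4 [H5 H6]].
  pose proof (Hg s) as G. pose proof (frenet_gT s) as GT.
  set (kk := kap s) in *.
  (* The expansion [g x (g x T) = g <g, T> - T <g, g>], kept unsimplified so that [ring] can close
     the goals below. *)
  assert (K : forall u w, kk * (w * (gx s * Tx s + gy s * Ty s + gz s * Tz s) - u * (gx s ^ 2 + gy s ^ 2 + gz s ^ 2)) = - kk * u).
  { intros. rewrite G, GT. ring. }
  split_and.
  - rewrite <- (K _ (gx s)). unfold Nx. auto_derive; [ex_der|].
    derive_with H2. derive_with H3. derive_with H5. derive_with H6. unfold Nx, Ny, Nz. ring.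
  - rewrite <- (K _ (gy s)). unfold Ny. auto_derive; [ex_der|].
    derive_with H1. derive_with H3. derive_with H4. derive_with H6. unfold Nx, Ny, Nz. ring.
  - rewrite <- (K _ (gz s)). unfold Nz. auto_derive; [ex_der|].
    derive_with H1. derive_with H2. derive_with H4. derive_with H5. unfold Nx, Ny, Nz. ring.
Qed.

Lemma frenet_Dkap (s : R) : is_derive kap s
  (det3 (gx s) (gy s) (gz s) (Tx s) (Ty s) (Tz s) (Bx s) (By s) (Bz s)).
Proof.
  pose proof (Dgx s) as H1. pose proof (Dgy s) as H2. pose proof (Dgz s) as H3.
  pose proof (DTx s) as H4. pose proof (DTy s) as H5. pose proof (DTz s) as H6.
  pose proof (DAx s) as H7. pose proof (DAy s) as H8. pose proof (DAz s) as H9.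
  unfold kap, det3. auto_derive; [ex_der|].
  derive_with H1. derive_with H2. derive_with H3. derive_with H4. derive_with H5.
  derive_with H6. derive_with H7. derive_with H8. derive_with H9. ring.
Qed.

Lemma frenet_ex_Dkap1 (s : R) : ex_derive Bx s -> ex_derive By s -> ex_derive Bz s ->
  ex_derive (fun s => det3 (gx s) (gy s) (gz s) (Tx s) (Ty s) (Tz s) (Bx s) (By s) (Bz s)) s.
Proof.
  intros EX EY EZ. pose proof (Dgx s) as H1. pose proof (Dgy s) as H2. pose proof (Dgz s) as H3.
  pose proof (DTx s) as H4. pose proof (DTy s) as H5. pose proof (DTz s) as H6.
  unfold det3. auto_derive. ex_der; easy.
Qed.

End Frenet.

(** * From the elastic equation to height and momentum *)

Lemma Rpower_sub1 (k p : R) : Rpower k (p - 1) = / Rpower k (1 - p).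
Proof. rewrite <- Rpower_Ropp. f_equal. ring. Qed.

Lemma Rpower_add1 (k p : R) : 0 < k -> Rpower k (p + 1) = k ^ 2 / Rpower k (1 - p).
Proof.
  intros Hk. replace (p + 1) with (1 + (1 + (p - 1))) by ring.
  rewrite !Rpower_plus, Rpower_sub1, !Rpower_1 by easy. unfold Rdiv. ring.
Qed.

Lemma Rpower_double (k q : R) : Rpower k (2 * q) = Rpower k q ^ 2.
Proof. replace (2 * q) with (q + q) by ring. rewrite Rpower_plus. ring. Qed.

Section Curvature.
Context (p : R) (Hp : 0 < p < 1) (E : R) (k k1 : R -> R).

Let a := level p E.
Let z (s : R) : R := height p a (k s).
Let nu (s : R) : R := momentum p a (k s).
Let z1 (s : R) : R := - ((1 - p) * z s * k1 s / k s).

Context (Hk : forall s, 0 < k s) (Dk : forall s, is_derive k s (k1 s))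
  (EDk1 : forall s, ex_derive k1 s).
Context (Helastic : forall s, p * Derive_n (fun t => Rpower (k t) (p - 1)) 2 s
   + (p - 1) * Rpower (k s) (p + 1) + p * Rpower (k s) (p - 1) = 0).
Context (Hfirst : forall s, p ^ 2 * (p - 1) ^ 2 * Rpower (k s) (2 * (p - 2)) * (k1 s) ^ 2
   + (p - 1) ^ 2 * Rpower (k s) (2 * p) + p ^ 2 * Rpower (k s) (2 * (p - 1)) = a).

Lemma curvature_DM (s : R) : is_derive (fun s => Rpower (k s) (1 - p)) s
  ((1 - p) * Rpower (k s) (1 - p) * k1 s / k s).
Proof.
  eapply is_derive_to_eq.
  - apply (is_derive_comp (fun k => Rpower k (1 - p)) k); [apply is_derive_Rpower, Hk|apply Dk].
  - unfold scal; cbn -[pow]; unfold mult; cbn -[pow]. field. pose proof (Hk s). lra.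
Qed.

Lemma curvature_Dz (s : R) : is_derive z s (z1 s).
Proof.
  pose proof (curvature_DM s) as H. pose proof (sqrt_level_pos p E) as Ha. fold a in Ha.
  pose proof (Rpower_pos (k s) (1 - p)). pose proof (Hk s).
  unfold z1, z, height. set (M := fun s => Rpower (k s) (1 - p)) in *.
  change (is_derive (fun s => p / (sqrt a * M s)) s (- ((1 - p) * (p / (sqrt a * M s)) * k1 s / k s))).
  change (is_derive M s ((1 - p) * M s * k1 s / k s)) in H.
  change (0 < M s) in H0.
  auto_derive.
  - ex_der. apply Rgt_not_eq. now apply Rmult_lt_0_compat.
  - derive_with H. field. lra.
Qed.

Lemma curvature_Dnu (s : R) : is_derive nu s (- k s * z1 s).
Proof.
  pose proof (curvature_DM s) as H. pose proof (sqrt_level_pos p E) as Ha. fold a in Ha.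
  pose proof (Rpower_pos (k s) (1 - p)). pose proof (Hk s). pose proof (Dk s) as H2.
  unfold z1, z, nu, height, momentum. set (M := fun s => Rpower (k s) (1 - p)) in *.
  change (is_derive (fun s => (1 - p) * k s / (sqrt a * M s)) s (- k s * - ((1 - p) * (p / (sqrt a * M s)) * k1 s / k s))).
  change (is_derive M s ((1 - p) * M s * k1 s / k s)) in H.
  change (0 < M s) in H0.
  auto_derive.
  - ex_der. apply Rgt_not_eq. now apply Rmult_lt_0_compat.
  - derive_with H. derive_with H2. field. lra.
Qed.

(** Since [Rpower k (p - 1)] is [sqrt a / p] times the height, the elastic equation is a formula for
    the second derivative of [z]. *)
Lemma curvature_Dz1 (s : R) : is_derive z1 s (k s * nu s - z s).
Proof.
  pose proof (sqrt_level_pos p E) as Ha. fold a in Ha.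
  pose proof (Rpower_pos (k s) (1 - p)) as HM. pose proof (Hk s) as Hks.
  assert (Hex : ex_derive z1 s).
  { pose proof (Dk s). pose proof (curvature_Dz s) as Hz. unfold z1.
    auto_derive. ex_der; first [exact (EDk1 s)|lra]. }
  apply Derive_correct in Hex. eapply is_derive_to_eq; [apply Hex|].
  pose proof (Helastic s) as He.
  assert (E2 : Derive_n (fun t => Rpower (k t) (p - 1)) 2 s = sqrt a / p * Derive z1 s).
  { rewrite (Derive_n_ext _ (fun t => sqrt a / p * z t)).
    - change (Derive (Derive (fun t => sqrt a / p * z t)) s = sqrt a / p * Derive z1 s).
      rewrite (Derive_ext _ (fun t => sqrt a / p * z1 t)); [apply Derive_scal|].
      intros t. rewrite Derive_scal. f_equal. apply is_derive_unique, curvature_Dz.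
    - intros t. rewrite Rpower_sub1. unfold z, height. pose proof (Rpower_pos (k t) (1 - p)). field. lra. }
  rewrite E2, Rpower_sub1, Rpower_add1 in He by easy.
  replace (p * (sqrt a / p * Derive z1 s)) with (sqrt a * Derive z1 s) in He by (field; lra).
  apply (Rmult_eq_reg_l (sqrt a)); [|lra].
  transitivity ((1 - p) * ((k s) ^ 2 / Rpower (k s) (1 - p)) - p * / Rpower (k s) (1 - p)); [lra|].
  unfold nu, z, momentum, height. field. lra.
Qed.

(** The first integral divided by [a], term by term. *)
Lemma curvature_unit (s : R) : z s ^ 2 + z1 s ^ 2 + nu s ^ 2 = 1.
Proof.
  pose proof (sqrt_level_pos p E) as Ha. pose proof (sqrt_level_sq p E) as Ha2. fold a in Ha, Ha2.
  pose proof (Rpower_pos (k s) (1 - p)) as HM. pose proof (Hk s) as Hks.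
  pose proof (Hfirst s) as H. rewrite !Rpower_double in H.
  replace (p - 2) with ((p - 1) + - (1)) in H by ring.
  rewrite Rpower_plus, Rpower_Ropp, Rpower_1 in H by easy.
  replace (Rpower (k s) p) with (Rpower (k s) (1 + (p - 1))) in H by (f_equal; ring).
  rewrite Rpower_plus, Rpower_1, Rpower_sub1 in H by easy.
  unfold z1, z, nu, height, momentum. set (r := sqrt a) in *. set (M := Rpower (k s) (1 - p)) in *.
  apply (Rmult_eq_reg_l (r * r)); [|apply Rgt_not_eq; now apply Rmult_lt_0_compat].
  transitivity a; [|lra]. rewrite <- H. field. lra.
Qed.

Lemma curvature_knu (s : R) : (1 - p) * (k s * z s) = p * nu s.
Proof. unfold z, nu, height, momentum, Rdiv. ring. Qed.

Lemma curvature_energy (s : R) : pot p (z s ^ 2) + ln ((1 - z s ^ 2) / nu s ^ 2) = E ^ 2.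
Proof.
  apply energy; auto. fold a. change (z s ^ 2 < 1).
  pose proof (curvature_unit s). pose proof (pow2_ge_0 (z1 s)).
  pose proof (pow_lt _ 2 (momentum_pos p Hp E (k s) (Hk s))). fold a in H1. change (0 < nu s ^ 2) in H1. lra.
Qed.

End Curvature.

Lemma smooth_derive (f : R -> R) : smooth f ->
  forall n s, is_derive (Derive_n f n) s (Derive_n f (S n) s).
Proof. intros Hf n s. apply Derive_correct. apply (Hf (S n) s). Qed.

Lemma shift_mult (f : R -> R) (T c : R) : (forall s, f (s + T) = f s + c) ->
  forall j s, f (s + INR j * T) = f s + INR j * c.
Proof.
  intros H j. induction j as [|j IH]; intros s.
  - simpl. rewrite !Rmult_0_l, !Rplus_0_r. easy.
  - rewrite S_INR. replace (s + (INR j + 1) * T) with (s + INR j * T + T) by ring.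
    rewrite H, IH. ring.
Qed.

Lemma is_derive_shift_eq (f f1 : R -> R) (T : R) : (forall s, is_derive f s (f1 s)) ->
  (forall s, f (s + T) = f s) -> forall s, f1 (s + T) = f1 s.
Proof.
  intros D P s.
  assert (H : is_derive (fun t => f (t + T)) s (f1 (s + T))).
  { pose proof (D (s + T)) as D'. auto_derive; [ex_der|]. derive_with D'. ring. }
  rewrite <- (is_derive_unique _ _ _ H), <- (is_derive_unique _ _ _ (D s)).
  now apply Derive_ext.
Qed.

(** Taking the inner product of the fixed-point equation with [u] removes the sine term. *)
Lemma planar_rotation_fix (ux uy uz vx vy vz c s : R) :
  0 < ux ^ 2 + uy ^ 2 + uz ^ 2 -> ux * vx + uy * vy + uz * vz = 0 ->
  ux * c + vx * s = ux -> uy * c + vy * s = uy -> uz * c + vz * s = uz -> c = 1.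
Proof.
  intros Hu Huv Hx Hy Hz.
  apply (Rmult_eq_reg_l (ux ^ 2 + uy ^ 2 + uz ^ 2)); [|lra].
  transitivity (ux * (ux * c + vx * s) + uy * (uy * c + vy * s) + uz * (uz * c + vz * s)
     - s * (ux * vx + uy * vy + uz * vz)); [ring|].
  rewrite Hx, Hy, Hz, Huv. ring.
Qed.

(** * Closing of the curve after [m] periods and not earlier *)

Section Closure.
Context (p : R) (Hp : 0 < p < 1) (E : R) (HE : 0 < E).
Context (gx gy gz : R -> R) (rho : R) (HG : is_gamma_a p (level p E) gx gy gz rho).

Let kap : R -> R := gcurv gx gy gz.
Let z (s : R) : R := height p (level p E) (kap s).
Let nu (s : R) : R := momentum p (level p E) (kap s).

Lemma angular_integrand_eq (s : R) : 0 < kap s ->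
  angular_integrand p (level p E) gx gy gz s = nu s / (1 - z s ^ 2).
Proof.
  intros Hk. unfold angular_integrand. change (gcurv gx gy gz s) with (kap s).
  unfold nu, z, momentum, height. rewrite Rpower_double.
  replace (2 - p) with (1 + (1 - p)) by ring. rewrite Rpower_plus, Rpower_1 by easy.
  pose proof (sqrt_level_pos p E) as Ha. pose proof (sqrt_level_sq p E) as Ha2.
  pose proof (Rpower_pos (kap s) (1 - p)) as HM.
  set (r := sqrt (level p E)) in *. set (M := Rpower (kap s) (1 - p)) in *.
  rewrite <- Ha2.
  assert (HrM : 0 < r * M) by now apply Rmult_lt_0_compat.
  (* Only positivity of the curvature is assumed, so the denominator may vanish; both quotients are
     then 0 because [/ 0 = 0]. *)
  destruct (Req_EM_T (r * r * M ^ 2 - p ^ 2) 0) as [E0|E0].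
  - replace (1 - (p / (r * M)) ^ 2) with ((r * r * M ^ 2 - p ^ 2) / (r * M) ^ 2) by (field; lra).
    rewrite E0. unfold Rdiv. rewrite !Rmult_0_l, Rinv_0. ring.
  - field. split_and; lra.
Qed.

Lemma closure (n m : nat) : (0 < m)%nat -> Nat.gcd n m = 1%nat ->
  Lam p E = 2 * PI * INR n / INR m ->
  (exists s t, gcurv gx gy gz s <> gcurv gx gy gz t) /\
  (forall s, gx (s + INR m * rho) = gx s /\ gy (s + INR m * rho) = gy s /\
             gz (s + INR m * rho) = gz s) /\
  (forall k : nat, (0 < k < m)%nat ->
     ~ (forall s, gx (s + INR k * rho) = gx s /\ gy (s + INR k * rho) = gy s /\
                  gz (s + INR k * rho) = gz s)) /\
  is_RInt (angular_integrand p (level p E) gx gy gz) 0 (INR m * rho) (2 * PI * INR n).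
Proof.
  intros Hm Hgcd HLam. pose proof PI_RGT_0 as HPI.
  destruct HG as [Sx [Sy [Sz [Hg [HT [Hk [He [Hf [Hnc [Hrho [Pk Hmin]]]]]]]]]]].
  change (forall s, 0 < kap s) in Hk.
  pose proof (smooth_derive gx Sx) as DX. pose proof (smooth_derive gy Sy) as DY.
  pose proof (smooth_derive gz Sz) as DZ.
  set (Tx := Derive_n gx 1). set (Ty := Derive_n gy 1). set (Tz := Derive_n gz 1).
  set (k1 := fun s => det3 (gx s) (gy s) (gz s) (Tx s) (Ty s) (Tz s)
      (Derive_n gx 3 s) (Derive_n gy 3 s) (Derive_n gz 3 s)).
  assert (Dk : forall s, is_derive kap s (k1 s)).
  { apply (frenet_Dkap gx gy gz Tx Ty Tz (Derive_n gx 2) (Derive_n gy 2) (Derive_n gz 2));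
      first [exact (DX 0%nat)|exact (DY 0%nat)|exact (DZ 0%nat)|exact (DX 1%nat)|exact (DY 1%nat)|exact (DZ 1%nat)
            |exact (DX 2%nat)|exact (DY 2%nat)|exact (DZ 2%nat)]. }
  assert (EDk1 : forall s, ex_derive k1 s).
  { intros s. apply (frenet_ex_Dkap1 gx gy gz Tx Ty Tz (Derive_n gx 2) (Derive_n gy 2) (Derive_n gz 2));
      first [exact (DX 0%nat)|exact (DY 0%nat)|exact (DZ 0%nat)|exact (DX 1%nat)|exact (DY 1%nat)|exact (DZ 1%nat)
            |apply (Sx 4%nat)|apply (Sy 4%nat)|apply (Sz 4%nat)]. }
  assert (Hf1 : forall s, p ^ 2 * (p - 1) ^ 2 * Rpower (kap s) (2 * (p - 2)) * (k1 s) ^ 2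
     + (p - 1) ^ 2 * Rpower (kap s) (2 * p) + p ^ 2 * Rpower (kap s) (2 * (p - 1)) = level p E).
  { intros s. rewrite <- (is_derive_unique _ _ _ (Dk s)). apply Hf. }
  set (z1 := fun s => - ((1 - p) * z s * k1 s / kap s)).
  pose proof (curvature_Dz p E kap k1 Hk Dk : forall s, is_derive z s (z1 s)) as Dz.
  pose proof (curvature_Dz1 p Hp E kap k1 Hk Dk EDk1 He : forall s, is_derive z1 s (kap s * nu s - z s)) as Dz1.
  pose proof (curvature_Dnu p E kap k1 Hk Dk : forall s, is_derive nu s (- kap s * z1 s)) as Dnu.
  pose proof (curvature_unit p E kap k1 Hk Hf1 : forall s, z s ^ 2 + z1 s ^ 2 + nu s ^ 2 = 1) as Hunit.
  pose proof (curvature_knu p E kap : forall s, (1 - p) * (kap s * z s) = p * nu s) as Hknu.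
  pose proof (curvature_energy p Hp E kap k1 Hk Hf1 : forall s, pot p (z s ^ 2) + ln ((1 - z s ^ 2) / nu s ^ 2) = E ^ 2) as Hen.
  assert (Hz : forall s, 0 < z s) by (intros s; now apply height_pos).
  assert (Hnu : forall s, 0 < nu s) by (intros s; now apply momentum_pos).
  assert (Pz : forall s, z (s + rho) = z s) by (intros s; unfold z, kap; now rewrite Pk).
  assert (Pnu : forall s, nu (s + rho) = nu s) by (intros s; unfold nu, kap; now rewrite Pk).
  pose proof (is_derive_shift_eq z z1 rho Dz Pz) as Pz1.
  assert (Hminz : forall t, 0 < t < rho -> ~ (forall s, z (s + t) = z s)).
  { intros t Ht H. apply (Hmin t Ht). intros s.
    apply (height_inj p Hp E); [apply Hk..|]. change (z (s + t) ^ 2 = z s ^ 2). now rewrite H. }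
  destruct (profile_angle p Hp E HE kap z z1 nu rho Hz Hnu Dz Dz1 Dnu Hunit Hknu Hen Hrho Pz Pz1 Pnu Hminz)
    as [Ph [Ph0 [DPh Pph]]].
  pose proof (shift_mult Ph rho (Lam p E) Pph) as PphJ.
  assert (PzJ : forall j s, z (s + INR j * rho) = z s).
  { intros j s. rewrite (shift_mult z rho 0); [ring|]. intros t. rewrite Pz. ring. }
  assert (HmR : 0 < INR m) by (apply lt_0_INR; easy).
  assert (HLm : INR m * Lam p E = 2 * INR n * PI) by (rewrite HLam; field; lra).
  set (Nx := fun s => gy s * Tz s - gz s * Ty s).
  set (Ny := fun s => gz s * Tx s - gx s * Tz s).
  set (Nz := fun s => gx s * Ty s - gy s * Tx s).
  assert (FT : forall s, is_derive Tx s (kap s * Nx s - gx s) /\ is_derive Ty s (kap s * Ny s - gy s) /\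
    is_derive Tz s (kap s * Nz s - gz s)).
  { apply (frenet_DT gx gy gz Tx Ty Tz (Derive_n gx 2) (Derive_n gy 2) (Derive_n gz 2));
      first [exact (DX 0%nat)|exact (DY 0%nat)|exact (DZ 0%nat)|exact (DX 1%nat)|exact (DY 1%nat)|exact (DZ 1%nat)
            |exact Hg|exact HT]. }
  assert (FN : forall s, is_derive Nx s (- kap s * Tx s) /\ is_derive Ny s (- kap s * Ty s) /\
    is_derive Nz s (- kap s * Tz s)).
  { apply (frenet_DN gx gy gz Tx Ty Tz (Derive_n gx 2) (Derive_n gy 2) (Derive_n gz 2));
      first [exact (DX 0%nat)|exact (DY 0%nat)|exact (DZ 0%nat)|exact (DX 1%nat)|exact (DY 1%nat)|exact (DZ 1%nat)
            |exact Hg|exact HT]. }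
  pose proof (coord_rotation gx Tx Nx kap z z1 nu Ph (DX 0%nat) (fun s => proj1 (FT s)) (fun s => proj1 (FN s))
    Dz Dz1 Dnu Hunit Hnu Ph0 DPh) as CX.
  pose proof (coord_rotation gy Ty Ny kap z z1 nu Ph (DY 0%nat) (fun s => proj1 (proj2 (FT s))) (fun s => proj1 (proj2 (FN s)))
    Dz Dz1 Dnu Hunit Hnu Ph0 DPh) as CY.
  pose proof (coord_rotation gz Tz Nz kap z z1 nu Ph (DZ 0%nat) (fun s => proj2 (proj2 (FT s))) (fun s => proj2 (proj2 (FN s)))
    Dz Dz1 Dnu Hunit Hnu Ph0 DPh) as CZ.
  assert (Hz1 : forall s, 0 < 1 - z s ^ 2).
  { intros s. pose proof (Hunit s). pose proof (pow2_ge_0 (z1 s)). pose proof (pow_lt _ 2 (Hnu s)). lra. }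
  split; [exact Hnc|]. split; [|split].
  - intros s.
    rewrite (CX (s + INR m * rho)), (CY (s + INR m * rho)), (CZ (s + INR m * rho)).
    rewrite PphJ, HLm, cos_period, sin_period, PzJ.
    rewrite <- (CX s), <- (CY s), <- (CZ s). easy.
  (* One point suffices: its part normal to the axis is nonzero and is returned by a rotation
     through [INR j * Lam p E], which must therefore be a whole number of turns. *)
  - intros j Hj Hall. specialize (Hall 0). rewrite Rplus_0_l in Hall.
    destruct Hall as [X [Y Z]].
    pose proof (PzJ j 0) as Zj. pose proof (PphJ j 0) as Pj. rewrite Rplus_0_l in Zj, Pj.
    rewrite Ph0, Rplus_0_l in Pj.
    rewrite CX, Zj, Pj in X. rewrite CY, Zj, Pj in Y. rewrite CZ, Zj, Pj in Z.
    pose proof (sqrt_lt_R0 _ (Hz1 0)) as Hr.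
    pose proof (Hg 0) as G1. pose proof (HT 0) as G2.
    pose proof (frenet_gT gx gy gz Tx Ty Tz (DX 0%nat) (DY 0%nat) (DZ 0%nat) Hg 0) as G3.
    pose proof (frenet_NN gx gy gz Tx Ty Tz (DX 0%nat) (DY 0%nat) (DZ 0%nat) Hg HT 0) as G4.
    change (Nx 0 ^ 2 + Ny 0 ^ 2 + Nz 0 ^ 2 = 1) in G4.
    change (Tx 0 ^ 2 + Ty 0 ^ 2 + Tz 0 ^ 2 = 1) in G2.
    assert (G5 : gx 0 * Nx 0 + gy 0 * Ny 0 + gz 0 * Nz 0 = 0) by (unfold Nx, Ny, Nz; ring).
    assert (G6 : Tx 0 * Nx 0 + Ty 0 * Ny 0 + Tz 0 * Nz 0 = 0) by (unfold Nx, Ny, Nz; ring).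
    pose proof (Hunit 0) as U.
    set (r := sqrt (1 - z 0 ^ 2)) in *.
    assert (Q : forall g0 T0 N0 e0 c s, z 0 * e0 + r * ((g0 - z 0 * e0) / r * c + (nu 0 * T0 - z1 0 * N0) / r * s) = g0 ->
      (g0 - z 0 * e0) * c + (nu 0 * T0 - z1 0 * N0) * s = g0 - z 0 * e0).
    { intros g0 T0 N0 e0 c s H.
      transitivity (r * ((g0 - z 0 * e0) / r * c + (nu 0 * T0 - z1 0 * N0) / r * s)); [field|]; lra. }
    apply Q in X. apply Q in Y. apply Q in Z.
    assert (C1 : cos (INR j * Lam p E) = 1).
    { refine (planar_rotation_fix _ _ _ _ _ _ _ _ _ _ X Y Z); unfold axis.
      (* The vector is [(1 - z^2) g - z z1 T - z nu N]; its squared length is expanded in the inner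
         products of the frame, and orthonormality leaves a sum of squares whose first term is
         positive. *)
      - match goal with |- 0 < ?e =>
          replace e with ((1 - z 0 ^ 2) ^ 2 * (gx 0 ^ 2 + gy 0 ^ 2 + gz 0 ^ 2)
           + (z 0 * z1 0) ^ 2 * (Tx 0 ^ 2 + Ty 0 ^ 2 + Tz 0 ^ 2)
           + (z 0 * nu 0) ^ 2 * (Nx 0 ^ 2 + Ny 0 ^ 2 + Nz 0 ^ 2)
           - 2 * (1 - z 0 ^ 2) * (z 0 * z1 0) * (gx 0 * Tx 0 + gy 0 * Ty 0 + gz 0 * Tz 0)
           - 2 * (1 - z 0 ^ 2) * (z 0 * nu 0) * (gx 0 * Nx 0 + gy 0 * Ny 0 + gz 0 * Nz 0)
           + 2 * (z 0 * z1 0) * (z 0 * nu 0) * (Tx 0 * Nx 0 + Ty 0 * Ny 0 + Tz 0 * Nz 0)) by ring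
        end.
        rewrite G1, G2, G3, G4, G5, G6.
        pose proof (pow_lt _ 2 (Hz1 0)). pose proof (pow2_ge_0 (z 0 * z1 0)). pose proof (pow2_ge_0 (z 0 * nu 0)). lra.
      - match goal with |- ?e = 0 =>
          replace e with ((1 - z 0 ^ 2) * nu 0 * (gx 0 * Tx 0 + gy 0 * Ty 0 + gz 0 * Tz 0)
           - (1 - z 0 ^ 2) * z1 0 * (gx 0 * Nx 0 + gy 0 * Ny 0 + gz 0 * Nz 0)
           - z 0 * z1 0 * nu 0 * (Tx 0 ^ 2 + Ty 0 ^ 2 + Tz 0 ^ 2)
           + z 0 * z1 0 * nu 0 * (Nx 0 ^ 2 + Ny 0 ^ 2 + Nz 0 ^ 2)
           + (z 0 * z1 0 ^ 2 - z 0 * nu 0 ^ 2) * (Tx 0 * Nx 0 + Ty 0 * Ny 0 + Tz 0 * Nz 0)) by ring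
        end.
        rewrite G2, G3, G4, G5, G6. ring. }
    apply cos_eq_1_multiple in C1. destruct C1 as [i Hi].
    assert (Hi2 : INR j * INR n = INR m * IZR i).
    { apply (Rmult_eq_reg_l (2 * PI)); [|lra].
      transitivity (INR m * (INR j * Lam p E)); [|rewrite Hi; ring].
      transitivity (INR j * (INR m * Lam p E)); [rewrite HLm|]; ring. }
    rewrite !INR_IZR_INZ, <- !mult_IZR in Hi2. apply eq_IZR in Hi2.
    (* From [j n = m i]; coprimality then forces [m] to divide [j], against [0 < j < m]. *)
    assert (Hd : Nat.divide m (n * j)).
    { exists (Z.to_nat i). nia. }
    apply Nat.gauss in Hd; [|now rewrite Nat.gcd_comm].
    apply Nat.divide_pos_le in Hd; lia.
  - apply (is_RInt_ext (fun s => nu s / (1 - z s ^ 2))).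
    { intros s _. symmetry. now apply angular_integrand_eq. }
    replace (2 * PI * INR n) with (minus (Ph (INR m * rho)) (Ph 0)).
    + apply (is_RInt_derive Ph (fun s => nu s / (1 - z s ^ 2))).
      * intros s _. apply DPh.
      * intros s _. apply (ex_derive_continuous (fun s => nu s / (1 - z s ^ 2))).
        pose proof (Dz s). pose proof (Dnu s). pose proof (Hz1 s).
        auto_derive. ex_der. simpl in *. lra.
    + pose proof (PphJ m 0) as H. rewrite Rplus_0_l, Ph0, HLm in H. rewrite H, Ph0.
      unfold minus, plus, opp; simpl. ring.
Qed.

End Closure.

Theorem mainTheorem8 (n m : nat) :
  Nat.gcd n m = 1%nat ->
  INR m < 2 * INR n -> 2 * INR n < sqrt 2 * INR m ->
  forall p : R, 0 < p < 1 ->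
  exists a : R, a_star p < a /\
    Lambda_is p a (2 * PI * INR n / INR m) /\
    forall (gx gy gz : R -> R) (rho : R), is_gamma_a p a gx gy gz rho ->
      (* non-constant curvature *)
      (exists s t, gcurv gx gy gz s <> gcurv gx gy gz t) /\
      (* closes up after m periods of the curvature *)
      (forall s, gx (s + INR m * rho) = gx s /\ gy (s + INR m * rho) = gy s /\
                 gz (s + INR m * rho) = gz s) /\
      (* and not earlier *)
      (forall k : nat, (0 < k < m)%nat ->
         ~ (forall s, gx (s + INR k * rho) = gx s /\ gy (s + INR k * rho) = gy s /\
                      gz (s + INR k * rho) = gz s)) /\
      (* total angular progression over m periods is 2 pi n *)
      is_RInt (angular_integrand p a gx gy gz) 0 (INR m * rho) (2 * PI * INR n).
Proof.
  intros Hgcd Hlow Hupp p Hp. pose proof PI_RGT_0 as HPI.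
  assert (Hm : (0 < m)%nat).
  (* For [m = 0] the two bounds would read [0 < 2 n < 0]. *)
  { destruct m; [|lia]. simpl in *. lra. }
  assert (HmR : 0 < INR m) by (apply lt_0_INR; easy).
  (* Multiplied by [PI / m], the hypothesis [m < 2 n < sqrt 2 m] places the target strictly between
     [PI] and [sqrt 2 * PI]. *)
  destruct (Lam_attains p Hp (2 * PI * INR n / INR m)) as [E [HE HL]].
  { split; apply (Rmult_lt_reg_r (INR m)); try easy;
      replace (2 * PI * INR n / INR m * INR m) with (PI * (2 * INR n)) by (field; lra).
    - apply Rmult_lt_compat_l; lra.
    - replace (sqrt 2 * PI * INR m) with (PI * (sqrt 2 * INR m)) by ring.
      apply Rmult_lt_compat_l; lra. }
  exists (level p E). split; [now apply level_gt|]. split.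
  - rewrite <- HL. now apply Lambda_is_Lam.
  - intros gx gy gz rho HG. now apply closure.
Qed.
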